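(* Let $m$ be the mean function of the non-stationary asymptotical regularization method (ARM) with ending time $T>0$ as described in the context, let $\varphi$ be the index function in the source condition $m_0-u^\dagger\in\mathcal A_\varphi$, and let $p>0$ be the exponent with $\Omega=(K^*K)^p$. Suppose that $\lambda\mapsto\varphi(\lambda)/\lambda^{p+1}$ is non-increasing. Define, for $\epsilon>0$, $$\Theta_\varphi(\epsilon):=\frac{\epsilon\,\varphi(\epsilon)}{\sqrt{\epsilon\,\mathcal N(\epsilon^{p+1})}}.$$ If the parameter is chosen as $\alpha=\alpha_*^\Theta$, where $\epsilon_*^\Theta=\big(\alpha_*^\Theta/T\big)^{1/(p+1)}$ is a solution of $$\Theta_\varphi(\epsilon_*^\Theta)=\sqrt{\tfrac1T},$$ then, with a constant $c$ independent of $T$, $$\mathbb E\|m(T)-u^\dagger\|^2\le c\,\varphi^2\Big(\Theta_\varphi^{-1}\big(\sqrt{\tfrac1T}\big)\Big)\qquad\text{as }T\to\infty,$$ i.e. for all sufficiently large $T$.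
   Context: Setting. $\mathcal X,\mathcal Y$ are separable Hilbert spaces, $A:\mathcal X\to\mathcal Y$ is a compact linear operator, $u^\dagger\in\mathcal X$ is the (deterministic) exact solution and $m_0\in\mathcal X$ a deterministic initial mean. The following is assumed. (Assumption on covariances) The noise covariance operator $\Sigma$ on $\mathcal Y$ is self-adjoint and positive definite. The initial covariance is $C_0=\alpha^{-1}\Omega$ with a parameter $\alpha>0$ and a self-adjoint, positive definite, trace class operator $\Omega$ on $\mathcal X$ (positive definite: $\langle x,\Omega x\rangle>0$ for $x\ne0$). (Assumption on operators) $\mathcal R(A)\subset\mathcal D(\Sigma^{-1/2})$, and $K:=\Sigma^{-1/2}A$; there is $p>0$ with $\Omega=(K^*K)^p$; and $\|K\|\le1$. (Source condition) An index function is a non-decreasing continuous function $\varphi:(0,\infty)\to(0,\infty)$ with $\lim_{\lambda\searrow0}\varphi(\lambda)=0$ (extended by $\varphi(0)=0$). For an index function $\varphi$, $m_0-u^\dagger\in\mathcal A_\varphi:=\{x:\ x=\varphi(K^*K)v,\ \|v\|\le1\}$. Put $B:=\Sigma^{-1/2}A\Omega^{1/2}=K\Omega^{1/2}$, so that $B^*B=(K^*K)^{p+1}$ and $\Omega=(B^*B)^{p/(p+1)}$. The effective dimension is $\mathcal N(\epsilon):=\operatorname{tr}\big((\epsilon I+B^*B)^{-1}B^*B\big)$ for $\epsilon>0$. Observation and method. The observed process is $\mathrm dz=Au^\dagger\,\mathrm dt+\sqrt\Sigma\,\mathrm dW$, $z(0)=0$, on $[0,T]$, where $W$ is a standard (cylindrical)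 Wiener process on $\mathcal Y$. The non-stationary ARM is the process $m$ solving $$\mathrm dm=(C_0^{-1}+tA^*\Sigma^{-1}A)^{-1}A^*\Sigma^{-1}(\mathrm dz-Am\,\mathrm dt),\qquad m(0)=m_0.$$ Here $A^*\Sigma^{-1}A$ and $A^*\Sigma^{-1/2}$ are understood as $K^*K$ and $K^*$. With $C(s):=(C_0^{-1}+sK^*K)^{-1}$ ($C(0)=C_0$), the solution is understood in the variation-of-constants sense $$u^\dagger-m(t)=e^{-\int_0^tC(s)K^*K\,\mathrm ds}(u^\dagger-m_0)-\int_0^te^{-\int_s^tC(\tau)K^*K\,\mathrm d\tau}C(s)K^*\,\mathrm dW(s).$$ $\mathbb E\|\cdot\|^2$ denotes the expected squared norm in $\mathcal X$. *)

(* Defs.v *)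
From HB Require Import structures.
From mathcomp Require Import all_boot all_order all_algebra.
From mathcomp Require Import all_classical all_reals all_analysis.

Set Implicit Arguments.
Unset Strict Implicit.
Unset Printing Implicit Defensive.

Import Order.TTheory GRing.Theory Num.Theory.
Import numFieldNormedType.Exports.

Local Open Scope classical_set_scope.
Local Open Scope ring_scope.

(* Real Hilbert spaces: complete normed spaces whose norm comes from an
   inner product. *)
HB.mixin Record NormedModule_isHilbert (R : realType) X
    & CompleteNormedModule R X := {
  inner : X -> X -> R ;
  innerC : forall x y, inner x y = inner y x ;
  inner_linearl : forall (a : R) x y z,
    inner (a *: x + y) z = a * inner x z + inner y z ;
  inner_norm : forall x, inner x x = `|x| ^+ 2 }.

#[short(type="hilbertType")]
HB.structure Definition Hilbert (R : realType) :=
  { X of CompleteNormedModule R X & NormedModule_isHilbert R X }.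

Definition separable (T : topologicalType) :=
  exists D : set T, countable D /\ dense D.

Section operators.
Variable R : realType.

(* Everywhere defined linear operators; unbounded operators only occur below
   as inverses, with the range of the operator being inverted as domain. *)
Definition compact_operator (X Y : hilbertType R) (T : X -> Y) :=
  compact (closure (T @` [set x | `|x| <= 1])).

Definition selfadjoint (X : hilbertType R) (T : X -> X) :=
  continuous T /\ forall x y, inner (T x) y = inner x (T y).

Definition positive_definite (X : hilbertType R) (T : X -> X) :=
  forall x, x != 0 -> 0 < inner x (T x).

(* S is the nonnegative selfadjoint square root of T. *)
Definition is_sqrt_op (X : hilbertType R) (T S : X -> X) :=
  [/\ selfadjoint S, forall x, 0 <= inner x (S x) & forall x, S (S x) = T x].

Definition adj (X Y : hilbertType R) (T : X -> Y) (y : Y) : X :=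
  xget 0 [set x | forall x', inner (T x') y = inner x' x].

(* T^* T *)
Definition normal_op (X Y : hilbertType R) (T : X -> Y) : X -> X :=
  fun x => adj T (T x).

(* The inverse, defined on f @` D, of f restricted to the domain D (it takes the
   junk value 0 outside f @` D). *)
Definition inv_on (U V : pointedType) (x0 : U) (D : set U) (f : U -> V) :
  V -> U := 'pinv_(fun=> x0) D f.

Definition op_inv (X Y : hilbertType R) (D : set X) (T : X -> Y) : Y -> X :=
  inv_on 0 D T.

Definition op_poly (X : hilbertType R) (q : {poly R}) (T : X -> X) (x : X) : X :=
  \sum_(i < size q) q`_i *: iter i T x.

(* Continuous functional calculus F = f(T) for a bounded nonnegative
   selfadjoint T, whose spectrum lies in [0, M] when M bounds the norm of T:
   F is the limit in operator norm of q_n(T), for polynomials q_n that converge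
   to f uniformly on [0, M]. *)
Definition is_op_fun (X : hilbertType R) (f : R -> R) (T F : X -> X) :=
  exists (M : R) (q : nat -> {poly R}),
  [/\ 0 <= M, forall x, `|T x| <= M * `|x|,
      forall e : R, 0 < e -> \forall n \near \oo,
        forall l, 0 <= l <= M -> `|(q n).[l] - f l| <= e &
      forall e : R, 0 < e -> \forall n \near \oo,
        forall x, `|op_poly (q n) T x - F x| <= e * `|x| ].

Definition op_exp (X : hilbertType R) (T : X -> X) (x : X) : X :=
  limn (series (fun n => (n`!%:R)^-1 *: iter n T x)).

(* Weak integral of an X-valued function on [a, b]. *)
Definition weak_int (X : hilbertType R) (a b : R) (f : R -> X) : X :=
  xget 0 [set z | forall x,
    (@lebesgue_measure R).-integrable `[a, b] (fun r => (inner (f r) x)%:E) /\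
    inner z x = \int[@lebesgue_measure R]_(r in `[a, b]) inner (f r) x].

Definition orthonormal_basis (X : hilbertType R) (E : set X) :=
  [/\ forall e, E e -> `|e| = 1,
      forall e e', E e -> E e' -> e != e' -> inner e e' = 0 &
      forall x, (forall e, E e -> inner x e = 0) -> x = 0].

(* Trace of a nonnegative operator; it does not depend on the orthonormal
   basis E, and such an operator is trace class iff its trace is finite. *)
Definition op_trace (X : hilbertType R) (E : set X) (T : X -> X) : \bar R :=
  \esum_(e in E) (inner (T e) e)%:E.

Definition effective_dim (X Y : hilbertType R) (E : set X) (B : X -> Y)
    (eps : R) : R :=
  fine (op_trace E (fun x =>
    op_inv setT (fun z => eps *: z + normal_op B z) (normal_op B x))).

Definition index_function (phi : R -> R) :=
  [/\ phi 0 = 0, forall x, 0 < x -> 0 < phi x,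
      forall x y, 0 < x -> x <= y -> phi x <= phi y,
      forall x, 0 < x -> {for x, continuous phi} &
      phi x @[x --> 0^'+] --> 0].

Definition source_set (X : hilbertType R) (phi : R -> R) (T : X -> X) : set X :=
  [set x | exists F : X -> X, is_op_fun phi T F /\
           exists2 v, `|v| <= 1 & x = F v].

Definition Theta (p : R) (phi N : R -> R) (eps : R) : R :=
  eps * phi eps / Num.sqrt (eps * N (eps `^ (p + 1))).

End operators.

Section stochastic.
Context {R : realType} {d : measure_display} {S : measurableType d}.
Variable P : probability S R.

(* The case v = 0 is separate because normal_prob m 0 is not a Dirac mass. *)
Definition centered_gaussian (Z : S -> R) (v : R) :=
  (v = 0 -> {ae P, forall w, Z w = 0}) /\
  (0 < v -> forall U : set R, measurable U ->
     P (Z @^-1` U) = normal_prob 0 (Num.sqrt v) U).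

(* Standard cylindrical Wiener process on [0, T]: the real random variables
   W t y, where W t y stands for <W(t), y>, are jointly Gaussian and centered
   with covariance E[(W t y) (W t' y')] = min(t, t') <y, y'>, and W _ y has
   continuous paths. Almost sure linearity in y, W 0 y = 0 and the independence
   of increments follow from the form of the covariance. *)
Definition cylindrical_wiener (Y : hilbertType R) (T : R)
    (W : R -> Y -> {RV P >-> R}) :=
  (forall (n : nat) (c t : 'I_n -> R) (y : 'I_n -> Y),
     (forall i, 0 <= t i <= T) ->
     centered_gaussian (fun w => \sum_i c i * W (t i) (y i) w)
       (\sum_i \sum_j c i * c j * Num.min (t i) (t j) * inner (y i) (y j))) /\
  (forall y, {ae P, forall w, {within `[0, T], continuous (fun t => W t y w)}}).

(* The Y-valued step function equal to y k on ]s k, s k.+1], for k < n, and its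
   integral against W. *)
Definition step_fun (Y : hilbertType R) (n : nat) (s : nat -> R) (y : nat -> Y)
    (r : R) : Y :=
  \sum_(k < n) \1_(`]s k, s k.+1]) r *: y k.

Definition step_int (Y : hilbertType R) (W : R -> Y -> {RV P >-> R}) (n : nat)
    (s : nat -> R) (y : nat -> Y) (w : S) : R :=
  \sum_(k < n) (W (s k.+1) (y k) w - W (s k) (y k) w).

(* I is the Wiener integral of <g(r), dW(r)> over [0, t], that is the mean square
   limit of the integrals of step functions converging to g in L^2([0, t]; Y). *)
Definition is_wiener_int (Y : hilbertType R) (W : R -> Y -> {RV P >-> R})
    (t : R) (g : R -> Y) (I : S -> R) :=
  exists (n : nat -> nat) (s : nat -> nat -> R) (y : nat -> nat -> Y),
  [/\ forall j, [/\ s j 0%N = 0, s j (n j) = t & nondecreasing_seq (s j)],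
      (\int[lebesgue_measure]_(r in `[0%R, t])
          (`|g r - step_fun (n j) (s j) (y j) r| ^+ 2)%:E)%E
        @[j --> \oo] --> 0%E &
      ('E_P[(fun w => (I w - step_int W (n j) (s j) (y j) w) ^+ 2)%R])%E
        @[j --> \oo] --> 0%E].

Definition hilbert_rv (X : hilbertType R) (Z : S -> X) :=
  forall U : set X, open U -> measurable (Z @^-1` U).

(* Z is the integral of the operator-valued function G : r |-> (Y -> X) against
   dW(r) over [0, t]: <Z, x> is the integral of <G(r)^* x, dW(r)> for all x. *)
Definition is_stoch_int (X Y : hilbertType R) (W : R -> Y -> {RV P >-> R})
    (t : R) (G : R -> Y -> X) (Z : S -> X) :=
  hilbert_rv Z /\
  forall x, is_wiener_int W t (fun r => adj (G r) x) (fun w => inner (Z w) x).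

End stochastic.

Section arm.
Variable R : realType.

(* C(s) = (C0^-1 + s K^* K)^-1, where C0^-1 has domain range C0. *)
Definition arm_cov (X Y : hilbertType R) (C0 : X -> X) (K : X -> Y) (s : R) :
  X -> X :=
  op_inv (range C0) (fun x => op_inv setT C0 x + s *: normal_op K x).

(* exp (- \int_s^t C(r) K^* K dr) *)
Definition arm_prop (X Y : hilbertType R) (C0 : X -> X) (K : X -> Y) (s t : R) :
  X -> X :=
  op_exp (fun x =>
    - weak_int s t (fun r => arm_cov C0 K r (normal_op K x))).

Definition is_arm (X Y : hilbertType R) (C0 : X -> X) (K : X -> Y) (u m0 : X)
    (T : R) (d : measure_display) (S : measurableType d)
    (P : probability S R) (W : R -> Y -> {RV P >-> R}) (m : R -> S -> X) :=
  forall t, 0 <= t <= T -> hilbert_rv (m t) /\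
  exists Z : S -> X,
    is_stoch_int W t
      (fun s y => arm_prop C0 K s t (arm_cov C0 K s (adj K y))) Z /\
    {ae P, forall w, u - m t w = arm_prop C0 K 0 t (u - m0) - Z w}.

End arm.

(* Main.v *)
Require Import Defs.
From HB Require Import structures.
From mathcomp Require Import all_boot all_order all_algebra.
From mathcomp Require Import all_classical all_reals all_analysis.
From mathcomp Require Import measurable_realfun ring lra.

Set Implicit Arguments.
Unset Strict Implicit.
Unset Printing Implicit Defensive.

Import Order.TTheory GRing.Theory Num.Theory.
Import numFieldNormedType.Exports.

Local Open Scope classical_set_scope.
Local Open Scope ring_scope.

(** The operators K^*K, Omega, B^*B, C(s) and the propagator of the method are
    all functions of K^*K, so that the theorem is a statement about scalars as
    soon as K^*K is diagonalised.

    Diagonalisation.  The trace condition makes sqrtOmega a Hilbert-Schmidt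
    operator, which sends bounded ultrafilters to convergent ones
    ([hilbert_schmidt_compact]).  Unit vectors that almost maximise the
    Rayleigh quotient of K^*K are approximate eigenvectors for its supremum l,
    and Omega = (K^*K)^p acts on them almost as multiplication by l^p
    ([op_fun_approx_eigen]).  Since Omega = sqrtOmega o sqrtOmega maps them to
    a convergent filter and l^p > 0, they converge to a true eigenvector.  The
    lemma of Zorn then gives a basis f_i with K^*K f_i = lam_i f_i, lam_i > 0
    ([gram_eigenbasis]).

    The method in this basis.  Put om_i = lam_i^p and mu_i = lam_i om_i =
    lam_i^(p+1).  Then C(s) K^*K has the eigenvalues
    mu_i / (alpha + s mu_i), the derivative in s of ln (alpha + s mu_i), so
    the propagator from s to t multiplies by
    (alpha + s mu_i) / (alpha + t mu_i) ([arm_prop_diag]).  In the stochastic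
    integral the numerator cancels against the denominator of C(s): the kernel
    is om_i / (alpha + T mu_i) K^*, which no longer depends on s
    ([arm_prop_cov_diag]).  Each coordinate of the noise is therefore a Wiener
    integral of a constant, and by Parseval the mean square of the noise is at
    most a constant times the sum of the
    T om_i^2 lam_i / (alpha + T mu_i)^2 ([arm_noise_second_moment]).

    Balance.  With alpha / T = eps^(p+1) the bias multiplier is
    eps^(p+1) / (eps^(p+1) + mu_i); multiplied by phi (lam_i) it stays below
    phi eps, by monotonicity of phi when lam_i <= eps and of
    phi (l) / l^(p+1) otherwise ([index_filter_le]).  The noise is at most a
    constant times N(eps^(p+1)) / (T eps) ([powR_filter_le]), and the equation
    Theta eps = sqrt (1 / T) says exactly that this quotient is phi(eps)^2.
    Finally N is non-increasing, hence Theta takes no positive value twice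
    ([Theta_injective]), and Theta^-1 (sqrt (1 / T)) is eps. *)

(** * Inner products and linear maps *)

Section inner_product.
Context {R : realType} {X : hilbertType R}.
Implicit Types x y z : X.

Lemma innerDl x y z : inner (x + y) z = inner x z + inner y z.
Proof. by have := inner_linearl 1 x y z; rewrite scale1r mul1r. Qed.

Lemma inner0l z : inner (0 : X) z = 0.
Proof. by apply: (addrI (inner 0 z)); rewrite -innerDl !addr0. Qed.

Lemma innerZl a x z : inner (a *: x) z = a * inner x z.
Proof. by have := inner_linearl a x 0 z; rewrite addr0 inner0l addr0. Qed.

Lemma innerNl x z : inner (- x) z = - inner x z.
Proof. by rewrite -scaleN1r innerZl mulN1r. Qed.

Lemma innerBl x y z : inner (x - y) z = inner x z - inner y z.
Proof. by rewrite innerDl innerNl. Qed.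

Lemma inner0r z : inner z (0 : X) = 0.
Proof. by rewrite innerC inner0l. Qed.

Lemma innerDr x y z : inner z (x + y) = inner z x + inner z y.
Proof. by rewrite !(innerC z) innerDl. Qed.

Lemma innerZr a x z : inner z (a *: x) = a * inner z x.
Proof. by rewrite !(innerC z) innerZl. Qed.

Lemma innerNr x z : inner z (- x) = - inner z x.
Proof. by rewrite !(innerC z) innerNl. Qed.

Lemma innerBr x y z : inner z (x - y) = inner z x - inner z y.
Proof. by rewrite !(innerC z) innerBl. Qed.

Lemma inner_suml (I : Type) (r : seq I) (P : pred I) (F : I -> X) z :
  inner (\sum_(i <- r | P i) F i) z = \sum_(i <- r | P i) inner (F i) z.
Proof.
by elim/big_rec2: _ => [|i a b _ <-]; rewrite ?inner0l ?innerDl.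
Qed.

Lemma inner_sumr (I : Type) (r : seq I) (P : pred I) (F : I -> X) z :
  inner z (\sum_(i <- r | P i) F i) = \sum_(i <- r | P i) inner z (F i).
Proof. by rewrite innerC inner_suml; apply: eq_bigr => i _; rewrite innerC. Qed.

Lemma inner_ge0 x : 0 <= inner x x.
Proof. by rewrite inner_norm exprn_ge0. Qed.

Lemma inner_eq0 x : (inner x x == 0) = (x == 0).
Proof. by rewrite inner_norm expf_eq0 /= normr_eq0. Qed.

Lemma inner_inj x y : (forall z, inner x z = inner y z) -> x = y.
Proof.
move=> xy; apply/eqP; rewrite -subr_eq0 -inner_eq0 innerBl xy.
by rewrite subrr.
Qed.

(** Expand the square of |x|^2 y - <x, y> x, which is nonnegative. *)
Lemma cauchy_schwarz x y : `|inner x y| <= `|x| * `|y|.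
Proof.
have [->|x0] := eqVneq x 0; first by rewrite inner0l !normr0 mul0r.
have nx : 0 < `|x| ^+ 2 by rewrite exprn_gt0 ?normr_gt0.
have := inner_ge0 (`|x| ^+ 2 *: y - inner x y *: x).
rewrite !(innerBl, innerBr, innerZl, innerZr) !inner_norm (innerC y x) => h.
rewrite -ler_sqr ?nnegrE ?mulr_ge0// real_normK ?num_real// exprMn.
rewrite -subr_ge0 -(pmulr_rge0 _ nx); apply: le_trans h _.
by rewrite le_eqVlt; apply/orP; left; apply/eqP; ring.
Qed.

Lemma inner_le x y : inner x y <= `|x| * `|y|.
Proof. exact: le_trans (ler_norm _) (cauchy_schwarz x y). Qed.

Lemma normD_sq x y : `|x + y| ^+ 2 <= 2 * `|x| ^+ 2 + 2 * `|y| ^+ 2.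
Proof.
have := inner_ge0 (x - y).
rewrite -!inner_norm !(innerDl, innerDr, innerNl, innerNr) (innerC y x).
by move=> h; lra.
Qed.

Lemma cvg_innerl (T : Type) (F : set_system T) {FF : Filter F} (f : T -> X) x z :
  f @ F --> x -> (inner (f t) z) @[t --> F] --> inner x z.
Proof.
move=> fx; apply/cvgrPdist_le => e e0.
have e1 : 0 < e / (`|z| + 1) by rewrite divr_gt0 // ltr_wpDl.
move/cvgrPdist_le: fx => /(_ _ e1); apply: filterS => t ht.
rewrite -innerBl; apply: le_trans (cauchy_schwarz _ _) _.
apply: le_trans (ler_wpM2r (normr_ge0 z) ht) _.
by rewrite -mulrA ler_piMr ?(ltW e0)// ler_pdivrMl ?ltr_wpDl// mulr1 lerDl.
Qed.

Lemma cvg_innerr (T : Type) (F : set_system T) {FF : Filter F} (f : T -> X) x z :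
  f @ F --> x -> (inner z (f t)) @[t --> F] --> inner z x.
Proof.
move=> /(cvg_innerl (z := z)); rewrite innerC.
by under eq_fun do rewrite innerC.
Qed.

Lemma norm_sq_le (x : X) (c : R) : 0 <= c -> `|x| ^+ 2 <= c * `|x| -> `|x| <= c.
Proof.
move=> c0; have [->|x0] := eqVneq x 0; first by rewrite normr0.
by rewrite expr2 ler_pM2r// normr_gt0.
Qed.

End inner_product.

(** Some of the maps below, such as the inverse of sqrtSigma composed with A,
    are bare functions, so that linearity is an equation rather than a bundled
    structure. *)
Section linear_equations.
Context {R : realType} {U V : lmodType R} (T : U -> V).
Hypothesis Tlin : forall a x y, T (a *: x + y) = a *: T x + T y.

Lemma lin0 : T 0 = 0.
Proof.
have := Tlin 1 0 0; rewrite !scale1r add0r => h.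
by apply: (addrI (T 0)); rewrite addr0 -h.
Qed.

Lemma linZ a x : T (a *: x) = a *: T x.
Proof. by have := Tlin a x 0; rewrite !addr0 lin0 addr0. Qed.

Lemma linD x y : T (x + y) = T x + T y.
Proof. by have := Tlin 1 x y; rewrite !scale1r. Qed.

Lemma linB x y : T (x - y) = T x - T y.
Proof. by rewrite -scaleN1r linD linZ scaleN1r. Qed.

Lemma lin_sum (I : Type) (r : seq I) (P : pred I) (F : I -> U) :
  T (\sum_(i <- r | P i) F i) = \sum_(i <- r | P i) T (F i).
Proof. by elim/big_rec2: _ => [|i a b _ <-]; rewrite ?lin0 ?linD. Qed.

End linear_equations.

Lemma cvg_bounded_linear {R : realType} {X Y : normedModType R} (T : X -> Y) (C : R)
    (I : Type) (F : set_system I) {FF : Filter F} (f : I -> X) (x : X) :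
  (forall a x y, T (a *: x + y) = a *: T x + T y) ->
  (forall x, `|T x| <= C * `|x|) ->
  f @ F --> x -> T (f t) @[t --> F] --> T x.
Proof.
move=> Tlin TC fx; apply/cvgrPdist_le => e e0.
have C0 : 0 < `|C| + 1 by rewrite ltr_wpDl.
move/cvgrPdist_le : fx => /(_ (e / (`|C| + 1))); rewrite divr_gt0// => /(_ isT).
apply: filterS => t ht; rewrite -(linB Tlin); apply: le_trans (TC _) _.
apply: (@le_trans _ _ ((`|C| + 1) * `|x - f t|)).
  by rewrite ler_wpM2r//; apply: le_trans (ler_norm C) _; rewrite lerDl.
by rewrite mulrC -ler_pdivlMr.
Qed.

(** * Orthonormal bases as sequences *)

Section orthonormal_sequences.
Context {R : realType} {X : hilbertType R}.
Implicit Types (x y z : X) (f : nat -> X) (c g : nat -> R).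

(** An orthonormal basis of a separable space, padded with zero vectors: this
    treats finite and infinite dimension alike, and a sum over the basis is an
    ordinary series.  The factor <f_i, f_i> in the formulas below is 1 or 0
    according to whether f_i is a basis vector or padding. *)
Definition basis_seq f :=
  [/\ forall i j, i != j -> inner (f i) (f j) = 0,
      forall i, f i = 0 \/ inner (f i) (f i) = 1 &
      forall x, (forall i, inner x (f i) = 0) -> x = 0].

Variable f : nat -> X.
Hypothesis fP : basis_seq f.

Lemma basis_coefE x i : inner x (f i) * inner (f i) (f i) = inner x (f i).
Proof.
have [_ /(_ i)[->|->] _] := fP; first by rewrite !inner0r mul0r.
by rewrite mulr1.
Qed.

Lemma basis_self i : 0 <= inner (f i) (f i) <= 1.
Proof.
by have [_ /(_ i)[->|->] _] := fP; rewrite ?inner0r ?lexx ?ler01.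
Qed.

Lemma basis_norm_le1 i : `|f i| <= 1.
Proof.
by have /andP[_] := basis_self i; rewrite inner_norm expr_le1.
Qed.

Lemma basis_ext x y : (forall i, inner x (f i) = inner y (f i)) -> x = y.
Proof.
have [_ _ tot] := fP => xy; apply/eqP; rewrite -subr_eq0; apply/eqP/tot => i.
by rewrite innerBl xy subrr.
Qed.

Lemma inner_lincomb c m n k :
  inner (\sum_(m <= i < n) c i *: f i) (f k) =
  if (m <= k < n)%N then c k * inner (f k) (f k) else 0.
Proof.
have [orth _ _] := fP.
rewrite inner_suml; case: ifP => [kmn|/negP kmn].
  rewrite (bigD1_seq k) ?mem_index_iota ?iota_uniq//= innerZl big1 ?addr0//.
  by move=> i ik; rewrite innerZl orth ?mulr0.
rewrite big_nat_cond big1// => i /andP[imn _].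
rewrite innerZl orth ?mulr0//; apply/eqP => ik; apply: kmn.
by rewrite -ik.
Qed.

Lemma norm_lincomb c m n :
  `|\sum_(m <= i < n) c i *: f i| ^+ 2 =
  \sum_(m <= i < n) c i ^+ 2 * inner (f i) (f i).
Proof.
rewrite -inner_norm inner_sumr; apply: eq_big_nat => i imn.
by rewrite innerZr inner_lincomb imn mulrA expr2.
Qed.

(** By [norm_lincomb] the partial sums are Cauchy as soon as those of the real
    series of squares are. *)
Lemma riesz_fischer c (C : R) :
  (forall n, \sum_(0 <= i < n) c i ^+ 2 * inner (f i) (f i) <= C) ->
  exists2 z, series (fun i => c i *: f i) @ \oo --> z &
    forall k, inner z (f k) = c k * inner (f k) (f k).
Proof.
move=> cC; pose u i := c i ^+ 2 * inner (f i) (f i).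
have u0 i : 0 <= u i by rewrite mulr_ge0 ?sqr_ge0 ?inner_ge0.
have : cvgn (series u).
  apply: nondecreasing_is_cvgn.
    by apply/nondecreasing_seqP => n; rewrite !seriesEnat/= big_nat_recr//= lerDl.
  by exists C => _ [n _ <-]; rewrite seriesEnat/=; exact: cC.
move=> /cvg_cauchy/cauchy_seriesP uC.
have /cauchy_cvg scvg : cauchy (series (fun i => c i *: f i) @ \oo).
  apply/cauchy_seriesP => e e0.
  have /uC : 0 < e ^+ 2 by rewrite exprn_gt0.
  apply: filterS => -[m n] /= h.
  rewrite -ltr_sqr ?nnegrE ?(ltW e0)// norm_lincomb.
  exact: le_lt_trans (ler_norm _) h.
exists (limn (series (fun i => c i *: f i))) => // k.
have h1 := cvg_innerl (z := f k) scvg.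
have h2 : inner (series (fun i => c i *: f i) n) (f k) @[n --> \oo] -->
    c k * inner (f k) (f k).
  apply: cvg_near_cst; exists k.+1 => // n /= kn.
  by rewrite seriesEnat/= inner_lincomb kn.
exact: (norm_cvg_unique (h1 _) h2).
Qed.

Lemma bessel x n : \sum_(0 <= i < n) inner x (f i) ^+ 2 <= `|x| ^+ 2.
Proof.
set s := \sum_(_ <= _ < _) _.
pose y := \sum_(0 <= i < n) inner x (f i) *: f i.
have xy : inner x y = s.
  by rewrite inner_sumr; apply: eq_bigr => i _; rewrite innerZr expr2.
have yy : inner y y = s.
  rewrite inner_norm norm_lincomb; apply: eq_bigr => i _.
  by rewrite expr2 -mulrA basis_coefE.
have := inner_ge0 (x - y).
rewrite -inner_norm !(innerBl, innerBr) (innerC y x) xy yy; lra.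
Qed.

(** The series converges by Bessel and [riesz_fischer], and its sum has the
    coordinates of x. *)
Lemma basis_expansion x : series (fun i => inner x (f i) *: f i) @ \oo --> x.
Proof.
have [|z zcvg zf] := @riesz_fischer (fun i => inner x (f i)) (`|x| ^+ 2).
  move=> n; apply: le_trans (bessel x n).
  by apply: ler_sum => i _; rewrite expr2 -mulrA basis_coefE.
suff zx : z = x by rewrite zx in zcvg.
by apply: basis_ext => i; rewrite zf basis_coefE.
Qed.

Lemma parseval x : series (fun i => inner x (f i) ^+ 2) @ \oo --> `|x| ^+ 2.
Proof.
rewrite -inner_norm.
apply: cvg_trans (cvg_innerr (z := x) (@basis_expansion x)).
apply: near_eq_cvg; apply: nearW => n.
by rewrite !seriesEnat/= inner_sumr; apply: eq_bigr => i _; rewrite innerZr expr2.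
Qed.

Lemma parseval_ereal x :
  (\sum_(0 <= i <oo) (inner x (f i) ^+ 2)%:E)%E = (`|x| ^+ 2)%:E.
Proof.
apply/cvg_lim => //; under eq_fun do rewrite sumEFin.
apply/cvg_EFin; first exact: nearW.
exact: parseval.
Qed.

(** Operators are compared through their coordinates: this is how every operator
    norm below is estimated. *)
Lemma norm_le_coef x y (C : R) : 0 <= C ->
  (forall i, `|inner x (f i)| <= C * `|inner y (f i)|) -> `|x| <= C * `|y|.
Proof.
move=> C0 xy; rewrite -ler_sqr ?nnegrE ?mulr_ge0//.
rewrite -(cvg_lim _ (@parseval x))//.
apply: limr_le; first by apply/cvg_ex; eexists; exact: parseval.
apply: nearW => n; rewrite seriesEnat/= exprMn.
apply: (@le_trans _ _ (C ^+ 2 * \sum_(0 <= i < n) inner y (f i) ^+ 2)).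
  rewrite mulr_sumr; apply: ler_sum => i _.
  rewrite -(real_normK (num_real (inner x _))) -(real_normK (num_real (inner y _))).
  by rewrite -exprMn ler_sqr ?nnegrE ?mulr_ge0.
by apply: ler_wpM2l (bessel _ _); rewrite exprn_ge0.
Qed.

Lemma functional_eq0 (L : X -> R) C :
  (forall a x y, L (a *: x + y) = a * L x + L y) ->
  (forall x, `|L x| <= C * `|x|) -> (forall i, L (f i) = 0) ->
  forall x, L x = 0.
Proof.
move=> Ll LC Lf x.
have L0 : L 0 = 0 := @lin0 R X R^o L Ll.
have Ls n : L (series (fun i => inner x (f i) *: f i) n) = 0.
  rewrite seriesEnat/=; elim: n => [|n ih]; first by rewrite big_nil.
  by rewrite big_nat_recr//= addrC Ll Lf mulr0 ih addr0.
have C0 : 0 <= `|C| by [].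
apply/eqP; rewrite -normr_le0; apply/ler_addgt0Pr => e e0; rewrite add0r.
have e1 : 0 < e / (`|C| + 1) by rewrite divr_gt0 // ltr_wpDl.
have /cvgrPdist_le/(_ _ e1)[n _ /(_ n (leqnn n))/= h] := @basis_expansion x.
have -> : L x = L (x - series (fun i => inner x (f i) *: f i) n).
  by rewrite -scaleN1r addrC Ll Ls mulr0 add0r.
apply: le_trans (LC _) _; apply: le_trans (ler_wpM2r (normr_ge0 _) (ler_norm C)) _.
apply: le_trans (ler_wpM2l C0 h) _.
by rewrite mulrCA ler_piMr ?(ltW e0)// ler_pdivrMr ?ltr_wpDl// mul1r lerDl.
Qed.

(** The candidate is the series of L(f_i) f_i.  Testing the bound on L against
    its own partial sums s_n gives |s_n|^2 = L(s_n) <= |C| |s_n|, which is the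
    bound that [riesz_fischer] asks for. *)
Lemma riesz_representation (L : X -> R) C :
  (forall a x y, L (a *: x + y) = a * L x + L y) ->
  (forall x, `|L x| <= C * `|x|) -> exists z, forall x, L x = inner x z.
Proof.
move=> Ll LC.
have L0 : L 0 = 0 := @lin0 R X R^o L Ll.
have LfE i : L (f i) * inner (f i) (f i) = L (f i).
  have [_ /(_ i)[->|->] _] := fP; first by rewrite L0 mul0r.
  by rewrite mulr1.
have Ls n : L (\sum_(0 <= i < n) L (f i) *: f i) =
    \sum_(0 <= i < n) L (f i) ^+ 2.
  elim: n => [|n ih]; first by rewrite !big_nil.
  by rewrite !big_nat_recr//= addrC Ll ih addrC expr2.
have [|z _ zf] := @riesz_fischer (fun i => L (f i)) (`|C| ^+ 2).
  move=> n; rewrite -norm_lincomb ler_sqr ?nnegrE//.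
  apply: norm_sq_le => //; rewrite norm_lincomb.
  under eq_bigr do rewrite expr2 -mulrA LfE -expr2.
  rewrite -Ls; apply: le_trans (ler_norm _) _; apply: le_trans (LC _) _.
  by rewrite ler_wpM2r// ler_norm.
exists z => x; apply/eqP; rewrite -subr_eq0; apply/eqP.
apply: (@functional_eq0 (fun x => L x - inner x z) (C + `|z|)) => [a x1 y|x1|i].
- by rewrite Ll innerDl innerZl; ring.
- apply: le_trans (ler_normB _ _) _; rewrite mulrDl lerD//.
  by rewrite mulrC cauchy_schwarz.
- by rewrite innerC zf LfE subrr.
Qed.

(** The diagonal operator of a bounded sequence g of eigenvalues. *)
Definition diag g x : X := limn (series (fun i => (g i * inner x (f i)) *: f i)).

Lemma diagE g C : (forall i, `|g i| <= C) ->
  forall x k, inner (diag g x) (f k) = g k * inner x (f k).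
Proof.
move=> gC x k.
have [|z zc zf] := @riesz_fischer (fun i => g i * inner x (f i)) (C ^+ 2 * `|x| ^+ 2).
  move=> n; apply: (@le_trans _ _ (C ^+ 2 * \sum_(0 <= i < n) inner x (f i) ^+ 2)).
    rewrite mulr_sumr; apply: ler_sum => i _.
    rewrite expr2 -mulrA -(mulrA (g i) _ (inner _ _)) basis_coefE mulrACA -!expr2.
    rewrite ler_wpM2r ?sqr_ge0// -real_normK ?num_real// ler_sqr ?nnegrE//.
    exact: le_trans (gC 0%N).
  by apply: ler_wpM2l (bessel _ _); rewrite sqr_ge0.
by rewrite /diag (cvg_lim _ zc)// zf -mulrA basis_coefE.
Qed.

Lemma diag_norm g C : (forall i, `|g i| <= C) ->
  forall x, `|diag g x| <= C * `|x|.
Proof.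
move=> gC x; apply: norm_le_coef; first exact: le_trans (gC 0%N).
by move=> i; rewrite (diagE gC) normrM ler_wpM2r.
Qed.

End orthonormal_sequences.
Section enumeration.
Context {R : realType} {X : hilbertType R}.

(** Distinct orthonormal vectors are at distance sqrt 2, so that points of a
    countable dense set chosen within 1/2 of them are distinct. *)
Lemma orthonormal_countable (E : set X) : separable X ->
  (forall e, E e -> `|e| = 1) ->
  (forall e e', E e -> E e' -> e != e' -> inner e e' = 0) -> countable E.
Proof.
move=> [D [/countable_injP[j jinj] Ddense]] E1 Eorth.
have near_D e : exists d, D d /\ `|e - d| < 2^-1.
  have [|d [/= ed Dd]] := Ddense (ball e (2^-1 : R)) _ (ball_open e _).
    by exists e; apply: ballxx; rewrite invr_gt0.
  by exists d; split => //; move: ed; rewrite -ball_normE.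
have [d dP] := choice near_D.
apply/countable_injP; exists (j \o d) => e e' /set_mem Ee /set_mem Ee' /= jj.
have [De ed] := dP e; have [De' ed'] := dP e'.
have dd : d e = d e' by apply: jinj => //; exact: mem_set.
apply/eqP; apply: contraT => ee'.
have : `|e - e'| ^+ 2 = 2.
  rewrite -inner_norm innerBl !innerBr !inner_norm (innerC e') Eorth// !E1//; ring.
have : `|e - e'| < 1.
  have -> : e - e' = (e - d e) + (d e' - e') by rewrite dd addrA subrK.
  apply: le_lt_trans (ler_normD _ _) _; rewrite (distrC (d e')).
  lra.
move=> h1 h2; have := normr_ge0 (e - e').
by move: h1 h2; move: (`|_|) => t; nra.
Qed.

(** The n-th vector is the element of E with code n, or 0 if n is not a code;
    hence the sum over E is the sum of the series for functions that vanish
    at 0. *)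
Lemma orthonormal_basis_seq (E : set X) : separable X -> orthonormal_basis E ->
  exists f : nat -> X, [/\ basis_seq f, forall i, f i = 0 \/ E (f i) &
    forall a : X -> \bar R, (forall x, 0 <= a x)%E -> a 0 = 0%E ->
      (\esum_(e in E) a e = \sum_(0 <= i <oo) a (f i))%E].
Proof.
move=> sepX [E1 Eorth Etot].
have /countable_injP[g ginj] := orthonormal_countable sepX E1 Eorth.
pose f n := xget 0 [set e | E e /\ g e = n].
have fg e : E e -> f (g e) = e.
  move=> Ee; apply: xget_unique => // e' [Ee' gee'].
  by apply: ginj => //; exact: mem_set.
have fE i : (f i = 0 /\ ~ (g @` E) i) \/ (E (f i) /\ g (f i) = i).
  rewrite /f; case: xgetP => [e _ [Ee ge]|ne]; first by right.
  by left; split => // -[e Ee ge]; exact: (ne e).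
exists f; split.
- split => [i j ij|i|x xf].
  + case: (fE i) => [[-> _]|[Ei gi]]; first by rewrite inner0l.
    case: (fE j) => [[-> _]|[Ej gj]]; first by rewrite inner0r.
    by apply: Eorth => //; apply: contra_neq ij => fij; rewrite -gi fij gj.
  + case: (fE i) => [[-> _]|[Ei gi]]; first by left.
    by right; rewrite inner_norm E1// expr1n.
  + by apply: Etot => e Ee; rewrite -(fg _ Ee).
- by move=> i; case: (fE i) => [[-> _]|[Ei _]]; [left|right].
- move=> a a0 az; rewrite nneseries_esumT//.
  transitivity (\esum_(e in E) a (f (g e)))%E.
    by apply: eq_esum => e Ee; rewrite fg.
  rewrite -(@esum_image _ _ _ E g (fun n => a (f n))) => [|e e' Ee Ee' gee']; last first.
    exact: ginj gee'.
  rewrite esum_mkcond; apply: eq_esum => n _; case: ifPn => // /negP nE.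
  case: (fE n) => [[-> _]//|[Ei gi]].
  by exfalso; apply: nE; rewrite -{1}gi; apply/mem_set; exists (f n).
Qed.

End enumeration.
(** * Traces and functional calculus *)

Section traces.
Context {R : realType} {X : hilbertType R}.

Lemma diag_quadratic (f : nat -> X) (fP : basis_seq f) (g : nat -> R) (C : R) :
  (forall i, 0 <= g i <= C) -> forall x,
  (\sum_(0 <= i <oo) (g i * inner x (f i) ^+ 2)%:E)%E =
  (inner (diag f g x) x)%:E.
Proof.
move=> gC x; have gC' i : `|g i| <= C by have /andP[g0 ?] := gC i; rewrite ger0_norm.
apply/cvg_lim => //; under eq_fun do rewrite sumEFin.
apply/cvg_EFin; first exact: nearW.
apply: cvg_trans (cvg_innerr (z := diag f g x) (basis_expansion fP (x := x))).
apply: near_eq_cvg; apply: nearW => n /=.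
rewrite seriesEnat/= inner_sumr; apply: eq_bigr => i _.
by rewrite innerZr (diagE fP gC') mulrCA expr2.
Qed.

(** Independence of the trace from the basis: exchange the two nonnegative
    series and apply Parseval with respect to e. *)
Lemma trace_diag (e f : nat -> X) (eP : basis_seq e) (fP : basis_seq f)
    (g : nat -> R) (C : R) : (forall i, 0 <= g i <= C) ->
  (\sum_(0 <= j <oo) (inner (diag f g (e j)) (e j))%:E)%E =
  (\sum_(0 <= i <oo) (g i * inner (f i) (f i))%:E)%E.
Proof.
move=> gC; have g0 i : 0 <= g i by case/andP: (gC i).
under eq_eseriesr do rewrite -(diag_quadratic fP gC).
rewrite (@nneseries_interchange _ (fun j i => (g i * inner (e j) (f i) ^+ 2)%:E) xpredT xpredT);
  last by move=> i j; rewrite lee_fin mulr_ge0 ?sqr_ge0.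
apply: eq_eseriesr => i _.
under eq_eseriesr do rewrite EFinM innerC.
rewrite nneseriesZl; last by move=> j _; rewrite lee_fin sqr_ge0.
by rewrite (parseval_ereal eP) inner_norm EFinM.
Qed.

End traces.

Section functional_calculus.
Context {R : realType} {X : hilbertType R}.
Variables (T : X -> X) (C : R).
Hypothesis Tlin : forall a x y, T (a *: x + y) = a *: T x + T y.
Hypothesis Tbd : forall x, `|T x| <= C * `|x|.
Hypothesis Tsym : forall x y, inner (T x) y = inner x (T y).

Lemma iter_approx_eigen (l : R) k : exists2 D : R, 0 <= D &
  forall x, `|iter k T x - l ^+ k *: x| <= D * `|T x - l *: x|.
Proof.
elim: k => [|k [D D0 ih]].
  by exists 0 => // x; rewrite mul0r expr0 scale1r subrr normr0.
exists (`|C| * D + `|l| ^+ k); first by rewrite addr_ge0 ?mulr_ge0 ?exprn_ge0.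
move=> x; rewrite iterS.
have -> : T (iter k T x) - l ^+ k.+1 *: x =
    T (iter k T x - l ^+ k *: x) + l ^+ k *: (T x - l *: x).
  by rewrite (linB Tlin) (linZ Tlin) scalerBr addrA subrK scalerA exprSr.
apply: le_trans (ler_normD _ _) _; rewrite mulrDl normrZ normrX lerD//.
apply: le_trans (Tbd _) _; rewrite -mulrA.
apply: le_trans (ler_wpM2r (normr_ge0 _) (ler_norm C)) _.
by rewrite ler_wpM2l.
Qed.

Lemma op_poly_approx_eigen (l : R) (q : {poly R}) : exists2 D : R, 0 <= D &
  forall x, `|op_poly q T x - q.[l] *: x| <= D * `|T x - l *: x|.
Proof.
have /choice[D DP] k : exists D : R, 0 <= D /\
    forall x, `|iter k T x - l ^+ k *: x| <= D * `|T x - l *: x|.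
  by have [D ? ?] := iter_approx_eigen l k; exists D.
exists (\sum_(i < size q) `|q`_i| * D i).
  by apply: sumr_ge0 => i _; rewrite mulr_ge0//; case: (DP i).
move=> x; rewrite /op_poly horner_coef scaler_suml -sumrB mulr_suml.
apply: le_trans (ler_norm_sum _ _ _) _; apply: ler_sum => i _.
rewrite -scalerA -scalerBr normrZ -mulrA ler_wpM2l//.
by case: (DP i).
Qed.

(** A function of T acts on an approximate eigenvector of T as on an exact one:
    this is clear for polynomials, where the error is controlled by the
    residual T x - l x, and passes to uniform limits at the price of the term
    e |x|.  The condition on the bounds M of T puts l into the interval on
    which the polynomials converge, whichever bound defines that interval. *)
Lemma op_fun_approx_eigen (h : R -> R) (F : X -> X) (l : R) :
  is_op_fun h T F -> 0 <= l ->
  (forall M : R, 0 <= M -> (forall x, `|T x| <= M * `|x|) -> l <= M) ->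
  forall e : R, 0 < e -> exists D : R, forall x,
    `|F x - h l *: x| <= D * `|T x - l *: x| + e * `|x|.
Proof.
move=> [M [q [M0 TM qh qF]]] l0 lM e e0.
have e2 : 0 < e / 2 by rewrite divr_gt0.
have [n [hn Fn]] : exists n, (forall l : R, 0 <= l <= M -> `|(q n).[l] - h l| <= e / 2) /\
    (forall x, `|op_poly (q n) T x - F x| <= e / 2 * `|x|).
  near \oo => n; exists n; split; near: n; [exact: qh|exact: qF].
have [D D0 DP] := op_poly_approx_eigen l (q n).
exists D => x.
have -> : F x - h l *: x = (op_poly (q n) T x - (q n).[l] *: x)
    + ((F x - op_poly (q n) T x) + ((q n).[l] - h l) *: x).
  by rewrite scalerBl addrCA !subrKA.
apply: le_trans (ler_normD _ _) _; apply: lerD => //.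
apply: le_trans (ler_normD _ _) _.
rewrite [e in X in _ <= X](splitr e) mulrDl lerD//; first by rewrite distrC.
by rewrite normrZ ler_wpM2r// hn// l0 lM.
Unshelve. all: by end_near. Qed.

Lemma op_fun_eigen (h : R -> R) (F : X -> X) (l : R) x :
  is_op_fun h T F -> 0 <= l -> T x = l *: x -> F x = h l *: x.
Proof.
move=> hF l0 Tx; have [->|x0] := eqVneq x 0.
  have [M [q [M0 TM qh qF]]] := hF.
  have [n _ /(_ n (leqnn n) 0)] := qF _ ltr01.
  rewrite normr0 mulr0 normr_le0 subr_eq0 scaler0 => /eqP <-.
  have iT k : iter k T 0 = 0 by elim: k => //= k ->; rewrite lin0.
  by rewrite /op_poly big1// => i _; rewrite iT scaler0.
apply/eqP; rewrite -subr_eq0 -normr_le0; apply/ler_addgt0Pr => e e0; rewrite add0r.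
have e1 : 0 < e / `|x| by rewrite divr_gt0 ?normr_gt0.
have [|D /(_ x)] := op_fun_approx_eigen hF l0 _ e1.
  move=> M M0 /(_ x); rewrite Tx normrZ ler_pM2r ?normr_gt0//.
  exact: le_trans (ler_norm _).
by rewrite Tx subrr normr0 mulr0 add0r divfK// normr_eq0.
Qed.

Lemma iter_sym k x y : inner (iter k T x) y = inner x (iter k T y).
Proof. by elim: k x y => // k ih x y; rewrite iterSr ih Tsym -iterS. Qed.

Lemma op_fun_sym (h : R -> R) (F : X -> X) x y :
  is_op_fun h T F -> inner (F x) y = inner x (F y).
Proof.
move=> [M [q [_ _ _ qF]]].
apply/eqP; rewrite -subr_eq0 -normr_le0; apply/ler_addgt0Pr => e e0; rewrite add0r.
pose N := 2 * `|x| * `|y| + 1.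
have N0 : 0 < N by rewrite ltr_wpDl// !mulr_ge0.
have e1 : 0 < e / N by rewrite divr_gt0.
have [n _ /(_ n (leqnn n)) /= h1] := qF _ e1.
have -> : inner (F x) y - inner x (F y) =
    inner x (op_poly (q n) T y - F y) - inner (op_poly (q n) T x - F x) y.
  rewrite innerBr innerBl.
  have -> : inner x (op_poly (q n) T y) = inner (op_poly (q n) T x) y.
    rewrite /op_poly inner_suml inner_sumr; apply: eq_bigr => i _.
    by rewrite innerZl innerZr iter_sym.
  ring.
apply: le_trans (ler_normB _ _) _.
apply: (@le_trans _ _ (e / N * (2 * `|x| * `|y|))).
  have -> : e / N * (2 * `|x| * `|y|) =
    `|x| * (e / N * `|y|) + (e / N * `|x|) * `|y| by ring.
  apply: lerD; (apply: le_trans (cauchy_schwarz _ _) _).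
    by rewrite ler_wpM2l.
  by rewrite ler_wpM2r.
rewrite -mulrA ler_piMr ?(ltW e0)// ler_pdivrMl// mulr1.
by rewrite lerDl.
Qed.

End functional_calculus.
(** * Diagonalisation of K^*K *)

(** The relation <H x, y> = <K x, K y> characterises H = K^*K and contains its
    linearity, symmetry and positivity. *)
Section gram_operators.
Context {R : realType} {X Y : hilbertType R}.
Variables (K : X -> Y) (H : X -> X).
Hypothesis Klin : forall a x y, K (a *: x + y) = a *: K x + K y.
Hypothesis K_le1 : forall x, `|K x| <= `|x|.
Hypothesis HE : forall x y, inner (H x) y = inner (K x) (K y).

Lemma gram_linear a x y : H (a *: x + y) = a *: H x + H y.
Proof.
by apply: inner_inj => z; rewrite innerDl innerZl !HE Klin innerDl innerZl.
Qed.

Lemma gram_sym x y : inner (H x) y = inner x (H y).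
Proof. by rewrite (innerC x) !HE innerC. Qed.

Lemma gram_le1 x : `|H x| <= 1 * `|x|.
Proof.
rewrite mul1r; apply: norm_sq_le => //; rewrite -inner_norm HE.
by apply: le_trans (inner_le _ _) _; rewrite ler_pM.
Qed.

(** Near-maximisers of the Rayleigh quotient are approximate eigenvectors.  The
    point is |H x|^2 <= l <H x, x> on the invariant set V, which follows from
    Cauchy-Schwarz for the form <H x, y>. *)
Lemma rayleigh_residual (V : set X) (l : R) : 0 <= l ->
  (forall x, V x -> V (H x)) -> (forall x, V x -> inner (H x) x <= l * `|x| ^+ 2) ->
  forall x, V x -> `|H x - l *: x| ^+ 2 <= l * (l * `|x| ^+ 2 - inner (H x) x).
Proof.
move=> l0 VH Vl x Vx.
have h : `|H x| ^+ 2 <= l * inner (H x) x.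
  have [->|Hx0] := eqVneq (H x) 0; first by rewrite normr0 inner0l expr0n/= mulr0.
  have nHx : 0 < `|H x| ^+ 2 by rewrite exprn_gt0 ?normr_gt0.
  have h1 : `|H x| ^+ 2 <= `|K x| * `|K (H x)|.
    by rewrite -inner_norm HE; exact: inner_le.
  have h2 : `|K (H x)| ^+ 2 <= l * `|H x| ^+ 2.
    by rewrite -inner_norm -HE; apply/Vl/VH.
  rewrite -(ler_pM2r nHx) HE inner_norm.
  apply: (@le_trans _ _ (`|K x| ^+ 2 * `|K (H x)| ^+ 2)).
    by rewrite -expr2 -exprMn ler_sqr ?nnegrE ?mulr_ge0 ?sqr_ge0.
  apply: le_trans (ler_wpM2l (sqr_ge0 _) h2) _.
  by rewrite le_eqVlt; apply/orP; left; apply/eqP; ring.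
rewrite -inner_norm !(innerBl, innerBr, innerZl, innerZr) (innerC x) !inner_norm.
move: h; lra.
Qed.

End gram_operators.

Lemma fmap_ultra (S T : Type) (f : S -> T) (U : set_system S) :
  UltraFilter U -> UltraFilter (f @ U).
Proof.
move=> UU; split; first exact: fmap_proper_filter.
move=> G GP UG; apply/seteqP; split => // B GB.
have [//|UB] := in_ultra_setVsetC (f @^-1` B) UU.
have : G (B `&` ~` B) by apply: filterI => //; exact: UG.
by rewrite setICr => /filter_not_empty.
Qed.

Section hilbert_schmidt.
Context {R : realType} {X : hilbertType R}.
Variables (e : nat -> X) (S : X -> X).
Hypothesis eP : basis_seq e.
Hypothesis Slin : forall a x y, S (a *: x + y) = a *: S x + S y.
Hypothesis Ssym : forall x y, inner (S x) y = inner x (S y).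

Let P N x := series (fun i => inner x (e i) *: e i) N.

(** The remainder S(x - P_N x) is estimated by duality: S is symmetric, so it
    suffices to estimate S w - P_N (S w), whose coordinates are <w, S e_i>. *)
Lemma hilbert_schmidt_tail N (tau : R) : 0 <= tau ->
  (forall n, \sum_(N <= i < n) `|S (e i)| ^+ 2 <= tau ^+ 2) ->
  forall x, `|S x - S (P N x)| <= tau * `|x|.
Proof.
move=> tau0 Stau.
have tail z : `|S z - P N (S z)| <= tau * `|z|.
  have cv : `|P n (S z) - P N (S z)| @[n --> \oo] --> `|S z - P N (S z)|.
    by apply: cvg_norm; apply: cvgB; [exact: basis_expansion|exact: cvg_cst].
  rewrite -(cvg_lim _ cv)//; apply: limr_le; first by apply/cvg_ex; eexists; exact: cv.
  exists N => // n /= Nn.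
  rewrite /P sub_series Nn -ler_sqr ?nnegrE ?mulr_ge0// (norm_lincomb eP) exprMn.
  apply: (@le_trans _ _ (\sum_(N <= i < n) `|S (e i)| ^+ 2 * `|z| ^+ 2)).
    apply: ler_sum => i _; rewrite expr2 -mulrA basis_coefE// -expr2 Ssym.
    rewrite -exprMn -real_normK ?num_real// ler_sqr ?nnegrE ?mulr_ge0// mulrC.
    exact: cauchy_schwarz.
  by rewrite -mulr_suml ler_wpM2r ?sqr_ge0.
move=> x; rewrite -(linB Slin); set w := S _.
apply: norm_sq_le; first by rewrite mulr_ge0.
rewrite -inner_norm {1}/w Ssym.
have -> : inner (x - P N x) (S w) = inner x (S w - P N (S w)).
  rewrite innerBl innerBr; congr (_ - _).
  rewrite /P !seriesEnat/= inner_suml inner_sumr; apply: eq_bigr => i _.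
  by rewrite innerZl innerZr mulrC (innerC (e i)).
apply: le_trans (inner_le _ _) _.
rewrite [tau * _]mulrC -mulrA ler_wpM2l//.
Qed.

(** Along an ultrafilter in the unit ball every coordinate converges, as it
    stays in [-1, 1].  So the images under S of the finite truncations
    converge, and by [hilbert_schmidt_tail] they are uniformly close to the
    images of the points themselves. *)
Lemma hilbert_schmidt_compact (U : set_system X) : UltraFilter U ->
  cvgn (series (fun i => `|S (e i)| ^+ 2)) ->
  U [set x | `|x| <= 1] -> cvg (S x @[x --> U]).
Proof.
move=> UU Scv Uball.
have /choice[l lP] i : exists l : R, inner x (e i) @[x --> U] --> l.
  have cpt : compact (`[-1, 1]%classic : set R) := @segment_compact R (-1) 1.
  rewrite compact_ultra in cpt.
  have [||l [_ ul]] := cpt (inner^~ (e i) @ U); last by exists l.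
    exact: fmap_ultra.
  rewrite /fmap/=; apply: filterS Uball => x /= x1.
  rewrite in_itv/= -ler_norml; apply: le_trans (cauchy_schwarz _ _) _.
  rewrite mulr_ile1//.
  exact: basis_norm_le1.
apply: cauchy_cvg; apply: cauchy_exP => eps eps0.
have h2 : 0 < eps / 2 by rewrite divr_gt0.
have h4 : 0 < eps / 4 by rewrite divr_gt0.
have /cvg_cauchy/cauchy_seriesP/(_ ((eps / 4) ^+ 2)) := Scv.
case; first by rewrite exprn_gt0.
move=> -[A B] /= [[N1 _ N1A] [N2 _ N2B]] AB.
pose N := maxn N1 N2.
have tailN n : \sum_(N <= i < n) `|S (e i)| ^+ 2 <= (eps / 4) ^+ 2.
  have [nN|Nn] := leqP n N; first by rewrite big_geq// sqr_ge0.
  apply: ltW; apply: le_lt_trans (ler_norm _) _.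
  apply: (AB (N, n)); split => /=; first by apply: N1A; rewrite /= leq_maxl.
  by apply: N2B; rewrite /=; apply: leq_trans (ltnW Nn); rewrite leq_maxr.
pose z := \sum_(0 <= i < N) l i *: S (e i).
exists z; rewrite /fmap/=.
have Scvz : S (P N x) @[x --> U] --> z.
  have -> : (fun x => S (P N x)) = fun x => \sum_(0 <= i < N) inner x (e i) *: S (e i).
    apply/funext => x; rewrite /P seriesEnat/= (lin_sum Slin).
    by apply: eq_bigr => i _; rewrite (linZ Slin).
  apply: cvg_big => [|i _]; first exact: add_continuous.
  by apply: cvgZr_tmp; exact: lP.
move/cvgrPdist_lt : Scvz => /(_ _ h2) Unear.
apply: filterS2 Uball Unear => x x1 zx; rewrite /= -ball_normE /=.
have -> : z - S x = (z - S (P N x)) - (S x - S (P N x)).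
  by rewrite opprB addrA subrK.
apply: le_lt_trans (ler_normB _ _) _.
rewrite [eps]splitr ltrD//.
apply: le_lt_trans (hilbert_schmidt_tail (ltW h4) tailN x) _.
apply: (@le_lt_trans _ _ (eps / 4)); last by lra.
by rewrite ler_piMr ?(ltW h4).
Qed.

End hilbert_schmidt.
Section spectral_theorem.
Context {R : realType} {X Y : hilbertType R}.
Variables (K : X -> Y) (H Om S : X -> X) (h : R -> R) (e : nat -> X).
Hypothesis Klin : forall a x y, K (a *: x + y) = a *: K x + K y.
Hypothesis K_le1 : forall x, `|K x| <= `|x|.
Hypothesis K_inj : forall x, K x = 0 -> x = 0.
Hypothesis HE : forall x y, inner (H x) y = inner (K x) (K y).
Hypothesis OmE : is_op_fun h H Om.
Hypothesis h_gt0 : forall l : R, 0 < l -> 0 < h l.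
Hypothesis Slin : forall a x y, S (a *: x + y) = a *: S x + S y.
Hypothesis Ssym : forall x y, inner (S x) y = inner x (S y).
Hypothesis Scont : continuous S.
Hypothesis SS : forall x, S (S x) = Om x.
Hypothesis eP : basis_seq e.
Hypothesis Scv : cvgn (series (fun i => `|S (e i)| ^+ 2)).

Let Hlin := gram_linear Klin HE.
Let Hle1 := gram_le1 K_le1 HE.

(** The compactness comes from S: approximate eigenvectors x with eigenvalue l
    satisfy Om x ~ h(l) x while Om x = S (S x) converges along an ultrafilter,
    so x itself converges because h(l) > 0. *)
Lemma gram_eigenvector (V : set X) : closed V ->
  (forall a x, V x -> V (a *: x)) -> (forall x, V x -> V (H x)) ->
  (exists2 x, V x & x != 0) ->
  exists (l : R) x, [/\ 0 < l <= 1, V x, `|x| = 1 & H x = l *: x].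
Proof.
move=> Vcl VZ VH [x0 Vx0 x0n].
have unitV x : V x -> x != 0 -> V (`|x|^-1 *: x) /\ `| `|x|^-1 *: x | = 1.
  move=> Vx xn; split; first exact: VZ.
  by rewrite normrZ normfV normr_id mulVf// normr_eq0.
pose Q := [set inner (H x) x | x in [set x | V x /\ `|x| = 1]].
have Hx1 x : `|x| = 1 -> inner (H x) x <= 1.
  move=> x1; apply: le_trans (inner_le _ _) _; rewrite x1 mulr1.
  by apply: le_trans (Hle1 x) _; rewrite x1 mulr1.
have Qsup : has_sup Q.
  split; last by exists 1 => _ [x [_ x1] <-]; exact: Hx1.
  by have [? ?] := unitV _ Vx0 x0n; eexists; exists (`|x0|^-1 *: x0).
pose l := sup Q.
have Ql q : Q q -> q <= l by move=> Qq; apply: ub_le_sup => //; case: Qsup.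
have l1 : l <= 1 by apply: ge_sup => [|_ [x [_ x1] <-]]; [case: Qsup|exact: Hx1].
have l0 : 0 < l.
  have [Vx1 x11] := unitV _ Vx0 x0n; set x1 := _ *: _ in Vx1 x11.
  apply: (@lt_le_trans _ _ (inner (H x1) x1)); last by apply: Ql; exists x1.
  rewrite HE inner_norm exprn_gt0// normr_gt0; apply/eqP => /K_inj x10.
  by move: x11; rewrite x10 normr0 => /esym/eqP; rewrite oner_eq0.
have Vl x : V x -> inner (H x) x <= l * `|x| ^+ 2.
  move=> Vx; have [->|xn] := eqVneq x 0; first by rewrite inner0r normr0 expr0n mulr0.
  have nx : 0 < `|x| ^+ 2 by rewrite exprn_gt0 ?normr_gt0.
  have [Vy y1] := unitV _ Vx xn.
  have : inner (H (`|x|^-1 *: x)) (`|x|^-1 *: x) <= l by apply: Ql; exists (`|x|^-1 *: x).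
  rewrite (linZ Hlin) innerZl innerZr mulrA -expr2 exprVn.
  by rewrite ler_pdivrMl// [X in _ <= X]mulrC.
have /choice[u uP] n : exists u, [/\ V u, `|u| = 1 & l - n.+1%:R^-1 < inner (H u) u].
  have n0 : 0 < n.+1%:R^-1 :> R by rewrite invr_gt0.
  by have [_ [x [Vx x1] <-] lx] := sup_adherent n0 Qsup; exists x.
have res n : `|H (u n) - l *: u n| ^+ 2 <= n.+1%:R^-1.
  have [Vu u1 lu] := uP n.
  apply: le_trans (rayleigh_residual HE (ltW l0) VH Vl Vu) _.
  rewrite u1 expr1n mulr1; apply: (@le_trans _ _ (1 * (l - inner (H (u n)) (u n)))).
    by rewrite ler_wpM2r// subr_ge0; apply: Ql; exists (u n).
  by rewrite mul1r lerBlDr addrC -lerBlDr ltW.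
(* An ultrafilter finer than the sequence u takes the place of a convergent
   subsequence. *)
have [U [UU uU]] := ultraFilterLemma (fmap_proper_filter u eventually_filter).
have uN (A : set X) : (\forall n \near \oo, A (u n)) -> U A by exact: uU.
have UV : U V by apply/uN/nearW => n; case: (uP n).
have U1 : U [set x | `|x| = 1] by apply/uN/nearW => n; case: (uP n).
have Ures : `|H x - l *: x| @[x --> U] --> 0.
  apply/cvgrPdist_le => d d0.
  apply: uN.
  have d2 : 0 < d ^+ 2 by rewrite exprn_gt0.
  have /cvgrPdist_le/(_ _ d2) := @cvg_harmonic R.
  apply: filterS => n /=.
  rewrite !sub0r !normrN normr_id => h1.
  rewrite -ler_sqr ?nnegrE ?(ltW d0)//; apply: le_trans (res n) _.
  exact: le_trans (ler_norm _) h1.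
have Uball : U [set x | `|x| <= 1] by apply: filterS U1 => x /= ->.
have /cvg_ex[z Sz] := hilbert_schmidt_compact eP Slin Ssym UU Scv Uball.
have Omz : Om x @[x --> U] --> S z.
  rewrite (_ : Om = S \o S); last by apply/funext => x /=; rewrite SS.
  exact: (continuous_cvg _ (@Scont z) Sz).
have hl := h_gt0 l0.
have Ux : x @[x --> U] --> (h l)^-1 *: S z.
  have Omh : Om x - h l *: x @[x --> U] --> 0.
    apply/cvgrPdist_le => d d0.
    have d2 : 0 < d / 2 by rewrite divr_gt0.
    have [|D DP] := op_fun_approx_eigen Hlin Hle1 OmE (ltW l0) _ d2.
      move=> M M0 HM; apply: ge_sup => [|_ [x [_ x1] <-]]; first by case: Qsup.
      apply: le_trans (inner_le _ _) _; rewrite x1 mulr1.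
      by apply: le_trans (HM x) _; rewrite x1 mulr1.
    have D0 : 0 < `|D| + 1 by rewrite ltr_wpDl.
    have d3 : 0 < d / 2 / (`|D| + 1) by rewrite divr_gt0.
    move/cvgrPdist_le : Ures => /(_ _ d3) Ures.
    apply: filterS2 Uball Ures => x /= x1; rewrite !sub0r !normrN normr_id => hx.
    apply: le_trans (DP x) _; rewrite [leRHS]splitr; apply: lerD.
      apply: (@le_trans _ _ ((`|D| + 1) * `|H x - l *: x|)).
        by rewrite ler_wpM2r//; apply: le_trans (ler_norm D) _; rewrite lerDl.
      by rewrite mulrC -ler_pdivlMr.
    by rewrite ler_piMr ?(ltW d2).
  have -> : (fun x : X => x) = fun x => (h l)^-1 *: (Om x - (Om x - h l *: x)).
    by apply/funext => x; rewrite subKr scalerA mulVf ?scale1r// gt_eqF.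
  rewrite -[S z]subr0; apply: cvgZl_tmp; exact: cvgB.
set w := _ *: _ in Ux.
exists l, w; split.
- by rewrite l0.
- exact: closed_cvg Ux.
- have h1 : `|x| @[x --> U] --> `|w| by exact: cvg_norm.
  have h2 : `|x| @[x --> U] --> (1 : R).
    by apply: cvg_near_cst; apply: filterS U1 => x /= ->.
  exact: (norm_cvg_unique h1 h2).
- have h1 : `|H x - l *: x| @[x --> U] --> `|H w - l *: w|.
    apply: cvg_norm; apply: cvgB; last exact: cvgZl_tmp.
    exact: (cvg_bounded_linear Hlin Hle1).
  apply/eqP; rewrite -subr_eq0 -normr_eq0; apply/eqP.
  exact: norm_cvg_unique h1 Ures.
Qed.

(** The orthogonal complement of a maximal orthonormal system of eigenvectors is
    invariant, so that by [gram_eigenvector] it is zero.  On the padding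
    vectors f_i = 0 the eigenvalue is set to 1, to keep it positive
    everywhere. *)
Lemma gram_eigenbasis : separable X -> exists (f : nat -> X) (lam : nat -> R),
  [/\ basis_seq f, forall i, 0 < lam i <= 1 &
      forall x i, inner (H x) (f i) = lam i * inner x (f i)].
Proof.
move=> sepX.
pose eigensystem := [set F : set X |
  (forall v, F v -> `|v| = 1 /\ exists2 l : R, 0 < l <= 1 & H v = l *: v) /\
  (forall v w, F v -> F w -> v != w -> inner v w = 0)].
have [|F [[FP Forth] Fmax]] := @Zorn_bigcup X eigensystem.
  move=> C Csub Ctot; split => [v [F CF Fv]|v w [F CF Fv] [G CG Gw] vw].
    by have [+ _] := Csub _ CF; apply.
  have [FG|GF] := Ctot _ _ CF CG.
    by have [_] := Csub _ CG; apply => //; exact: FG.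
  by have [_] := Csub _ CF; apply => //; exact: GF.
pose V := [set x | forall v, F v -> inner x v = 0].
have Vclosed : closed V.
  have -> : V = \bigcap_(v in F) [set x | inner x v = 0] by [].
  apply: closed_bigI => v _.
  apply: (@preimage_closed _ _ (inner^~ v) [set 0]); last exact: closed_eq.
  by move=> x _; apply: (@cvg_innerl R X X (nbhs x) _ id x v); exact: cvg_id.
have FB : orthonormal_basis F.
  split => [v /FP[]//|//|x xF]; apply/eqP; apply: contraT => xn.
  have [|||l [y [l01 Vy y1 Hy]]] := gram_eigenvector Vclosed.
  - by move=> a z Vz v Fv; rewrite innerZl Vz// mulr0.
  - move=> z Vz v Fv; have [_ [l _ Hv]] := FP _ Fv.
    by rewrite (gram_sym HE) Hv innerZr Vz// mulr0.
  - by exists x.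
  have /Fmax : F `<` F `|` [set y].
    split; first by move=> v; left.
    move=> /(_ y (or_intror erefl)) Fy.
    have /eqP := Vy _ Fy; rewrite inner_eq0 -normr_eq0 y1.
    by rewrite oner_eq0.
  case; split => [v [Fv|->]|v w [Fv|->] [Fw|->] vw].
  - exact: FP.
  - by split => //; exists l.
  - exact: Forth.
  - by rewrite innerC; exact: Vy.
  - exact: Vy.
  - by rewrite eqxx in vw.
have [f [fP fF _]] := orthonormal_basis_seq sepX FB.
have /choice[lam lamP] i : exists l : R, 0 < l <= 1 /\ H (f i) = l *: f i.
  have [->|/FP[_ [l l01 Hl]]] := fF i; last by exists l.
  by exists 1; rewrite (lin0 Hlin) scaler0 ltr01 lexx.
exists f, lam; split => // [i|x i]; first by case: (lamP i).
by rewrite (gram_sym HE); have [_ ->] := lamP i; rewrite innerZr.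
Qed.

End spectral_theorem.
(** * Exponentials and weak integrals of diagonal operators *)

Section operator_exponential.
Context {R : realType}.

(** The remainder of the exponential series at a is dominated termwise by the
    one at L; this makes the convergence uniform over the eigenvalues. *)
Lemma expR_partial_sum (a L : R) N : `|a| <= L ->
  `|expR a - series (exp_coeff a) N| <= expR L - series (exp_coeff L) N.
Proof.
move=> aL.
have cvE x : series (exp_coeff x) @ \oo --> expR x by exact: is_cvg_series_exp_coeff.
have h1 : `|series (exp_coeff a) M - series (exp_coeff a) N| @[M --> \oo] -->
    `|expR a - series (exp_coeff a) N|.
  by apply: cvg_norm; apply: cvgB; [exact: cvE|exact: cvg_cst].
have h2 : series (exp_coeff L) M - series (exp_coeff L) N @[M --> \oo] -->
    expR L - series (exp_coeff L) N.
  by apply: cvgB; [exact: cvE|exact: cvg_cst].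
apply: ler_cvg_to h1 h2 _; exists N => // M /= NM.
rewrite !sub_series NM; apply: le_trans (ler_norm_sum _ _ _) _.
apply: ler_sum => n _; rewrite /exp_coeff /= normrM normrX [ `|_^-1|]ger0_norm ?invr_ge0//.
by rewrite ler_wpM2r ?invr_ge0// lerXn2r ?nnegrE//; exact: le_trans aL.
Qed.

Context {X : hilbertType R}.
Variable f : nat -> X.
Hypothesis fP : basis_seq f.

Lemma op_exp_diag (T : X -> X) (a : nat -> R) (L : R) x :
  (forall i, `|a i| <= L) ->
  (forall x i, inner (T x) (f i) = a i * inner x (f i)) ->
  op_exp T x = diag f (fun i => expR (a i)) x.
Proof.
move=> aL Ta.
have iterT n i : inner (iter n T x) (f i) = a i ^+ n * inner x (f i).
  by elim: n => [|n ih]; rewrite ?expr0 ?mul1r//= Ta ih mulrA -exprS.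
have eL i : `|expR (a i)| <= expR L.
  by rewrite ger0_norm ?expR_ge0// ler_expR; apply: le_trans (ler_norm _) _.
apply/cvg_lim => //; apply/cvgrPdist_le => e e0.
have e1 : 0 < e / (`|x| + 1) by rewrite divr_gt0// ltr_wpDl.
have /cvgrPdist_le/(_ _ e1) : series (exp_coeff L) @ \oo --> expR L.
  exact: is_cvg_series_exp_coeff.
apply: filterS => N /= hN.
apply: (@le_trans _ _ (e / (`|x| + 1) * `|x|)); last first.
  by rewrite -mulrA ler_piMr ?(ltW e0)// ler_pdivrMl ?ltr_wpDl// mulr1 lerDl.
apply: (norm_le_coef fP); first exact: ltW.
move=> i; rewrite innerBl (diagE fP eL).
have -> : inner (series (fun n => (n`!%:R)^-1 *: iter n T x) N) (f i) =
    series (exp_coeff (a i)) N * inner x (f i).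
  rewrite !seriesEnat/= inner_suml mulr_suml; apply: eq_bigr => n _.
  by rewrite innerZl iterT /exp_coeff/= mulrA (mulrC _^-1).
rewrite -mulrBl normrM ler_wpM2r//.
apply: le_trans (expR_partial_sum N (aL i)) _.
exact: le_trans (ler_norm _) hN.
Qed.

End operator_exponential.

Lemma lipschitz_integrable {R : realType} (g : R -> R) (D a b : R) :
  (forall r r', `|g r - g r'| <= D * `|r - r'|) ->
  (@lebesgue_measure R).-integrable `[a, b] (EFin \o g).
Proof.
move=> gD; apply: continuous_compact_integrable; first exact: segment_compact.
apply: continuous_subspaceT => r; apply/cvgrPdist_le => e e0.
have D0 : 0 < `|D| + 1 by rewrite ltr_wpDl.
near=> r'; apply: le_trans (gD _ _) _.
apply: (@le_trans _ _ ((`|D| + 1) * `|r - r'|)).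
  by rewrite ler_wpM2r// ler_wpDr// ler_norm.
rewrite mulrC -ler_pdivlMr//; near: r'.
by apply: (@cvgr_dist_le _ _ _ (nbhs r) _ id r); rewrite ?divr_gt0//; exact: cvg_id.
Unshelve. all: by end_near. Qed.

Section weak_integral.
Context {R : realType} {X : hilbertType R}.
Variable f : nat -> X.
Hypothesis fP : basis_seq f.

Lemma weak_int_unique (a b : R) (F : R -> X) (z : X) :
  (forall x,
    (@lebesgue_measure R).-integrable `[a, b] (fun r => (inner (F r) x)%:E) /\
    inner z x = \int[@lebesgue_measure R]_(r in `[a, b]) inner (F r) x) ->
  weak_int a b F = z.
Proof.
move=> h; apply: xget_unique => // z' h'; apply: inner_inj => x.
by rewrite (h x).2 (h' x).2.
Qed.

Lemma lebesgue_itvcc (a b : R) : a <= b ->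
  fine (@lebesgue_measure R `[a, b]) = b - a.
Proof.
move=> ab; rewrite lebesgue_measure_itv/=.
rewrite lte_fin; case: ltP => //= ba.
have -> : a = b by apply: le_anti; rewrite ab ba.
by rewrite subrr.
Qed.

(** Both sides, paired with y, are bounded linear functionals of y that agree on
    the basis.  The Lipschitz condition makes the integrands continuous, and
    hence integrable, uniformly in the eigenvalue index. *)
Lemma weak_int_diag (a b C D : R) (c : R -> nat -> R) (l : nat -> R) (F : R -> X) x :
  a <= b ->
  (forall r i, `|c r i| <= C) ->
  (forall r r' i, `|c r i - c r' i| <= D * `|r - r'|) ->
  (forall i, `|l i| <= C * (b - a)) ->
  (forall i, \int[@lebesgue_measure R]_(r in `[a, b]) c r i = l i) ->
  (forall r, r \in `[a, b] -> F r = diag f (c r) x) ->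
  weak_int a b F = diag f l x.
Proof.
move=> ab cC cD lC cl FE.
have C0 : 0 <= C := le_trans (normr_ge0 _) (cC 0 0%N).
have icont y : (@lebesgue_measure R).-integrable `[a, b]
    (EFin \o (fun r => inner (diag f (c r) x) y)).
  apply: (lipschitz_integrable (D := `|D| * `|x| * `|y|)) => r r'; rewrite -innerBl.
  apply: le_trans (cauchy_schwarz _ _) _.
  have -> : `|D| * `|x| * `|y| * `|r - r'| = `|D| * `|r - r'| * `|x| * `|y| by ring.
  rewrite ler_wpM2r//; apply: (norm_le_coef fP); first by rewrite mulr_ge0.
  move=> i; rewrite innerBl !(diagE fP (cC _)) -mulrBl normrM ler_wpM2r//.
  by apply: le_trans (cD r r' i) _; rewrite ler_wpM2r ?ler_norm.
pose I y := \int[@lebesgue_measure R]_(r in `[a, b]) inner (diag f (c r) x) y.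
have mab : measurable (`[a, b]%classic : set (measurableTypeR R)) by [].
have Ilin k y z : I (k *: y + z) = k * I y + I z.
  rewrite /I -(RintegralZl k mab (icont y)).
  rewrite -(RintegralD mab (integrableZl mab k (icont y)) (icont z)).
  by apply: eq_Rintegral => r _; rewrite innerDr innerZr.
have Ibd y : `|I y| <= C * (b - a) * `|x| * `|y|.
  apply: le_trans (le_normr_Rintegral mab (icont y)) _.
  apply: (@le_trans _ _ (\int[@lebesgue_measure R]_(r in `[a, b]) (C * `|x| * `|y|))).
    apply: le_Rintegral => //.
    - exact: (integrable_norm (icont y)).
    - apply: continuous_compact_integrable; first exact: segment_compact.
      by apply: continuous_subspaceT => r; exact: cvg_cst.
    - move=> r _; apply: le_trans (cauchy_schwarz _ _) _.
      by rewrite ler_wpM2r// (diag_norm fP).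
  rewrite Rintegral_cst// lebesgue_itvcc// le_eqVlt; apply/orP; left; apply/eqP; ring.
apply: weak_int_unique => y; split.
  have := icont y; apply: eq_integrable => // r; rewrite inE /= => rab.
  by rewrite FE.
transitivity (I y); last by apply: eq_Rintegral => r; rewrite inE /= => rab; rewrite FE.
apply/eqP; rewrite -subr_eq0; apply/eqP.
apply: (functional_eq0 fP (L := fun y => inner (diag f l x) y - I y)
  (C := `|diag f l x| + C * (b - a) * `|x|)) => [k u v|u|i].
- by rewrite Ilin innerDr innerZr; ring.
- apply: le_trans (ler_normB _ _) _; rewrite mulrDl lerD//.
  exact: cauchy_schwarz.
- rewrite (diagE fP lC); apply/eqP; rewrite subr_eq0 -cl; apply/eqP.
  rewrite -RintegralZr//.
    by apply: eq_Rintegral => r _; rewrite (diagE fP (cC r)).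
  by apply: (lipschitz_integrable (D := D)) => r r'; exact: cD.
Qed.

End weak_integral.
(** * The operators of the method in the eigenbasis *)

Section op_inverse.
Context {R : realType} {X Y : hilbertType R}.

Lemma op_inv_eq (D : set X) (T : X -> Y) (x : X) (y : Y) :
  (forall x x', D x -> D x' -> T x = T x' -> x = x') -> D x -> T x = y ->
  op_inv D T y = x.
Proof.
move=> Tinj Dx <-; apply: pinvKV; last exact: mem_set.
by move=> u v /set_mem Du /set_mem Dv; exact: Tinj.
Qed.

Lemma adj_eq (T : X -> Y) (y : Y) (z : X) :
  (forall x, inner (T x) y = inner x z) -> adj T y = z.
Proof.
move=> Tz; apply: xget_unique => // z' Tz'.
by apply: inner_inj => x; rewrite innerC -Tz' Tz innerC.
Qed.

End op_inverse.

Section arm_operators.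
Context {R : realType} {X Y : hilbertType R}.
Variables (K : X -> Y) (Om : X -> X) (f : nat -> X) (lam om : nat -> R) (alpha : R).
Hypothesis fP : basis_seq f.
Hypothesis lam01 : forall i, 0 < lam i <= 1.
Hypothesis om01 : forall i, 0 < om i <= 1.
Hypothesis Klam : forall x i, inner (normal_op K x) (f i) = lam i * inner x (f i).
Hypothesis Omom : forall x i, inner (Om x) (f i) = om i * inner x (f i).
Hypothesis alpha_gt0 : 0 < alpha.

Local Notation C0 := (fun x => alpha^-1 *: Om x).
Local Notation mu i := (lam i * om i).

Let mu01 i : 0 < mu i <= 1.
Proof.
have /andP[l0 l1] := lam01 i; have /andP[p0 p1] := om01 i.
by rewrite mulr_gt0//= mulr_ile1// ltW.
Qed.

Let den_gt0 (s : R) i : 0 <= s -> 0 < alpha + s * mu i.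
Proof. by move=> s0; have /andP[m0 _] := mu01 i; rewrite ltr_pwDl// mulr_ge0// ltW. Qed.

Let ratio_bound (s c : R) i : 0 <= s -> 0 <= c <= 1 -> `|c / (alpha + s * mu i)| <= alpha^-1.
Proof.
move=> s0 /andP[c0 c1]; have d0 := den_gt0 i s0; have /andP[m0 _] := mu01 i.
rewrite ger0_norm ?divr_ge0 ?(ltW d0)//.
apply: (@le_trans _ _ (1 / (alpha + s * mu i))).
  by rewrite ler_wpM2r// invr_ge0 ltW.
by rewrite div1r lef_pV2 ?posrE// lerDl mulr_ge0// ltW.
Qed.

(** The inverse of C0^-1 + s K^*K at y is C0 z, where z solves the bounded
    equation z + s K^*K C0 z = y; here z has the multiplier
    alpha / (alpha + s mu_i). *)
Lemma arm_cov_diag (s : R) y : 0 <= s ->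
  arm_cov C0 K s y = diag f (fun i => om i / (alpha + s * mu i)) y.
Proof.
move=> s0.
have C0E x i : inner (C0 x) (f i) = alpha^-1 * om i * inner x (f i).
  by rewrite innerZl Omom mulrA.
have C0inj x x' : C0 x = C0 x' -> x = x'.
  move=> xx'; apply: (basis_ext fP) => i; have /andP[p0 _] := om01 i.
  apply: (@mulfI _ (alpha^-1 * om i)); first by rewrite gt_eqF// mulr_gt0// invr_gt0.
  by rewrite -!C0E xx'.
have C0K x : op_inv setT C0 (C0 x) = x by apply: op_inv_eq => // u v _ _; exact: C0inj.
have TE z i : inner (op_inv setT C0 (C0 z) + s *: normal_op K (C0 z)) (f i) =
    (alpha + s * mu i) / alpha * inner z (f i).
  rewrite C0K innerDl innerZl Klam C0E.
  by field; rewrite gt_eqF.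
have omb i : `|om i / (alpha + s * mu i)| <= alpha^-1.
  by have /andP[/ltW ? ?] := om01 i; apply: ratio_bound => //; apply/andP.
have alb i : `|alpha / (alpha + s * mu i)| <= 1.
  have d0 := den_gt0 i s0; have /andP[m0 _] := mu01 i.
  rewrite ger0_norm ?divr_ge0 ?(ltW d0) ?(ltW alpha_gt0)//.
  by rewrite ler_pdivrMr// mul1r lerDl mulr_ge0// ltW.
have xE : C0 (diag f (fun i => alpha / (alpha + s * mu i)) y) =
    diag f (fun i => om i / (alpha + s * mu i)) y.
  apply: (basis_ext fP) => i; rewrite C0E !(diagE fP alb, diagE fP omb).
  by field; rewrite !gt_eqF// den_gt0.
apply: op_inv_eq.
- move=> _ _ [z _ <-] [z' _ <-] zz'; congr C0; apply: (basis_ext fP) => i.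
  have d0 := den_gt0 i s0.
  apply: (@mulfI _ ((alpha + s * mu i) / alpha)).
    by rewrite gt_eqF// divr_gt0.
  by rewrite -!TE zz'.
- by exists (diag f (fun i => alpha / (alpha + s * mu i)) y).
- apply: (basis_ext fP) => i; rewrite -xE TE (diagE fP alb).
  by field; rewrite !gt_eqF// den_gt0.
Qed.

(** The absolute value only extends the integrand to a Lipschitz function on the
    whole line; on [s, t] it is r. *)
Lemma Rintegral_logarithmic (m s t : R) : 0 < m -> 0 <= s -> s <= t ->
  \int[@lebesgue_measure R]_(r in `[s, t]) (m / (alpha + `|r| * m)) =
  ln (alpha + t * m) - ln (alpha + s * m).
Proof.
move=> m0 s0; rewrite le_eqVlt => /predU1P[<-|st].
  by rewrite set_itv1 Rintegral_set1 subrr.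
have den r : 0 <= r -> 0 < alpha + r * m by move=> r0; rewrite ltr_pwDl// mulr_ge0// ltW.
pose F (r : R) : R^o := ln (alpha + r * m).
have dF (r : R) : 0 <= r -> is_derive r 1 F (m / (alpha + r * m)).
  move=> r0; have d0 := den r r0.
  pose lin (r : R) : R := alpha + r * m.
  have dlin : is_derive r 1 lin m.
    have h := is_deriveD (is_derive_cst alpha r 1)
      (is_deriveM (is_derive_id r 1) (is_derive_cst m r 1)).
    apply: (is_derive_eq h).
    by rewrite scaler0 !add0r /cst /= [_ *: 1]mulr1.
  rewrite mulrC.
  exact: (@is_derive1_comp _ (@ln R) lin r _ _ (is_derive1_ln d0) dlin).
have cF (r : R) : 0 <= r -> F x @[x --> r] --> F r.
  move=> /dF [dr _].
  by have /derivable1_diffP/differentiable_continuous := dr.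
rewrite /Rintegral (@continuous_FTC2 _ (fun r => m / (alpha + `|r| * m)) F s t)//.
- apply: continuous_subspaceT => r; apply: cvgM; first exact: cvg_cst.
  apply: cvgV; first by rewrite gt_eqF// den.
  apply: cvgD; first exact: cvg_cst.
  by apply: cvgM; [apply: cvg_norm; exact: cvg_id|exact: cvg_cst].
- split.
  + move=> r; rewrite in_itv/= => /andP[sr _].
    by have [] := dF r (le_trans s0 (ltW sr)).
  + by apply: cvg_at_right_filter; exact: cF.
  + by apply: cvg_at_left_filter; apply: cF; exact: le_trans (ltW st).
- move=> r; rewrite in_itv/= => /andP[sr _].
  have r0 := le_trans s0 (ltW sr).
  by rewrite derive1E (dF r r0).(@derive_val _ _ _ _ _ _ _) ger0_norm.
Qed.

Lemma arm_prop_diag (s t : R) x : 0 <= s -> s <= t ->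
  arm_prop C0 K s t x =
  diag f (fun i => (alpha + s * mu i) / (alpha + t * mu i)) x.
Proof.
move=> s0 st.
pose c (r : R) i := mu i / (alpha + `|r| * mu i).
pose l i := ln (alpha + t * mu i) - ln (alpha + s * mu i).
have t0 := le_trans s0 st.
have cb r i : `|c r i| <= alpha^-1.
  by apply: ratio_bound => //; have /andP[/ltW -> ->] := mu01 i.
have cl i : \int[@lebesgue_measure R]_(r in `[s, t]) c r i = l i.
  by rewrite Rintegral_logarithmic//; case/andP: (mu01 i).
have l0 i : 0 <= l i.
  rewrite subr_ge0 ler_ln ?posrE ?den_gt0// lerD2l ler_wpM2r//.
  by case/andP: (mu01 i) => /ltW.
have lb i : `|l i| <= alpha^-1 * (t - s).
  rewrite ger0_norm// /l -ln_div ?posrE ?den_gt0//.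
  have ds := den_gt0 i s0; have dt := den_gt0 i t0; have /andP[m0 m1] := mu01 i.
  have -> : (alpha + t * mu i) / (alpha + s * mu i) =
      1 + (t - s) * (mu i / (alpha + s * mu i)).
    by field; rewrite gt_eqF.
  have h0 : 0 <= mu i / (alpha + s * mu i) by rewrite divr_ge0// ltW.
  apply: le_trans (le_ln1Dx _) _.
    by rewrite (lt_le_trans (ltrN10 _))// mulr_ge0// subr_ge0.
  rewrite mulrC ler_wpM2r ?subr_ge0//.
  have := @ratio_bound s (mu i) i s0; rewrite (ltW m0) m1 => /(_ isT).
  by rewrite ger0_norm.
have cD r r' i : `|c r i - c r' i| <= alpha^-1 ^+ 2 * `|r - r'|.
  have dr := den_gt0 i (normr_ge0 r); have dr' := den_gt0 i (normr_ge0 r').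
  have -> : c r i - c r' i = c r i * c r' i * (`|r'| - `|r|).
    by rewrite /c; field; rewrite !gt_eqF.
  rewrite normrM; apply: ler_pM => //.
    by rewrite normrM expr2; apply: ler_pM.
  by rewrite (distrC r); exact: ler_dist_dist.
have weakE y : weak_int s t (fun r => arm_cov C0 K r (normal_op K y)) = diag f l y.
  apply: (weak_int_diag fP st cb cD lb cl) => r; rewrite in_itv/= => /andP[sr _].
  have r0 := le_trans s0 sr.
  rewrite arm_cov_diag//; apply: (basis_ext fP) => i.
  have omb j : `|om j / (alpha + r * mu j)| <= alpha^-1.
    by have /andP[/ltW ? ?] := om01 j; apply: ratio_bound => //; apply/andP.
  rewrite (diagE fP omb) (diagE fP (cb r)) Klam /c ger0_norm//; ring.
rewrite /arm_prop.
rewrite (@op_exp_diag _ _ _ fP _ (fun i => - l i) (alpha^-1 * (t - s))).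
- congr (diag f _ x); apply/funext => i.
  rewrite /l opprB -ln_div ?posrE ?den_gt0// lnK// posrE.
  by rewrite divr_gt0 ?den_gt0.
- by move=> i; rewrite normrN.
- by move=> y i; rewrite weakE innerNl (diagE fP lb) mulNr.
Qed.

(** The numerator alpha + s mu_i of the propagator is the denominator of C(s), so
    that their product does not depend on s. *)
Lemma arm_prop_cov_diag (s t : R) y : 0 <= s -> s <= t ->
  arm_prop C0 K s t (arm_cov C0 K s y) =
  diag f (fun i => om i / (alpha + t * mu i)) y.
Proof.
move=> s0 st; have t0 := le_trans s0 st.
rewrite arm_prop_diag// arm_cov_diag//; apply: (basis_ext fP) => i.
have omb r j : 0 <= r -> `|om j / (alpha + r * mu j)| <= alpha^-1.
  by move=> r0; have /andP[/ltW ? ?] := om01 j; apply: ratio_bound => //; apply/andP.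
have rb j : `|(alpha + s * mu j) / (alpha + t * mu j)| <= 1.
  have ds := den_gt0 j s0; have dt := den_gt0 j t0; have /andP[m0 m1] := mu01 j.
  rewrite ger0_norm; last by rewrite divr_ge0// ltW.
  rewrite ler_pdivrMr// mul1r lerD2l ler_wpM2r//.
  exact: ltW.
rewrite (diagE fP rb) (diagE fP (fun j => omb s j s0)) (diagE fP (fun j => omb t j t0)).
by field; rewrite !gt_eqF ?den_gt0.
Qed.

End arm_operators.
(** * Gaussian second moments *)

Section gaussian_second_moment.
Context {R : realType}.
Local Notation mu := (@lebesgue_measure R).

(** The density is a Radon-Nikodym derivative, which is unique almost
    everywhere. *)
Lemma ge0_integral_normal_prob (m s : R) (f : measurableTypeR R -> \bar R) :
  (forall x, 0 <= f x)%E -> measurable_fun setT f ->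
  (\int[normal_prob m s]_x f x = \int[mu]_x (f x * (normal_pdf m s x)%:E))%E.
Proof.
move=> f0 mf.
have dom := normal_prob_dominates m s.
rewrite -(Radon_Nikodym_SigmaFinite.change_of_variables dom f0 measurableT mf).
have mpdf : measurable_fun [set: measurableTypeR R] (fun x => (normal_pdf m s x)%:E).
  by apply/measurable_EFinP; exact: measurable_normal_pdf.
have intRN := Radon_Nikodym_SigmaFinite.f_integrable dom.
apply: ae_eq_integral => //.
- by apply: emeasurable_funM => //; exact: (measurable_int mu).
- exact: emeasurable_funM.
- apply: ae_eqe_mul2l; apply: integral_ae_eq => //= A _ mA.
  by rewrite -Radon_Nikodym_SigmaFinite.f_integral.
Qed.

(** Three quarters of the Gaussian exponent absorb the factor x^2; the remaining
    quarter belongs to the Gaussian of deviation 2 s, whose integral is known.  With b = x^2 / (8 s^2) the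
    claim is 2 b exp (- 3 b) <= 1.  Integration yields the bound 8 s^2 for the
    second moment, which serves as well as its exact value s^2 when constants
    do not matter. *)
Lemma normal_pdf_second_moment (s x : R) : 0 < s ->
  x ^+ 2 * normal_pdf 0 s x <= 8 * s ^+ 2 * normal_pdf 0 (2 * s) x.
Proof.
move=> s0; have s2 : 0 < s ^+ 2 by rewrite exprn_gt0.
rewrite !normal_pdfE ?gt_eqF ?mulr_gt0//.
have peakE : normal_peak s = 2 * normal_peak (2 * s).
  rewrite /normal_peak exprMn -(mulrA (2 ^+ 2)) -!mulrnAr.
  by rewrite (sqrtrM _ (sqr_ge0 2)) sqrtr_sqr ger0_norm// invfM mulrA mulfV ?mul1r.
set b := x ^+ 2 / (8 * s ^+ 2).
have b0 : 0 <= b by rewrite divr_ge0 ?sqr_ge0// mulr_ge0 ?sqr_ge0.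
have funE : normal_fun 0 (2 * s) x = expR (- b).
  rewrite /normal_fun subr0 /b; congr expR; field; exact: lt0r_neq0.
have -> : normal_fun 0 s x = expR (- b) * expR (- (3 * b)).
  rewrite -expRD /normal_fun subr0 /b; congr expR; field; exact: lt0r_neq0.
have xE : x ^+ 2 = 8 * s ^+ 2 * b by rewrite /b; field; exact: lt0r_neq0.
have bexp : 2 * b * expR (- (3 * b)) <= 1.
  rewrite expRN ler_pdivrMr ?expR_gt0// mul1r.
  by apply: le_trans (expR_ge1Dx _); lra.
rewrite peakE funE xE.
have -> : 8 * s ^+ 2 * b * (2 * normal_peak (2 * s) * (expR (- b) * expR (- (3 * b))))
  = 8 * s ^+ 2 * (normal_peak (2 * s) * expR (- b)) * (2 * b * expR (- (3 * b))) by ring.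
by rewrite ler_piMr// !mulr_ge0 ?expR_ge0 ?normal_peak_ge0 ?(ltW s0).
Qed.

Context {d : measure_display} {S : measurableType d}.
Variable P : probability S R.

Lemma centered_gaussian_second_moment (Z : S -> R) (v : R) : measurable_fun setT Z ->
  0 <= v -> centered_gaussian P Z v ->
  (\int[P]_w (Z w ^+ 2)%:E <= (8 * v)%:E)%E.
Proof.
move=> mZ v0 [Z0 Zv].
have mZ2 : measurable_fun [set: S] (fun w => (Z w ^+ 2)%:E).
  by apply/measurable_EFinP; exact: measurable_funX.
move: v0; rewrite le_eqVlt => /predU1P[v0|v0].
  rewrite -v0 mulr0 (_ : integral _ _ _ = 0)%E//.
  rewrite -[RHS](integral0 P setT); apply: ae_eq_integral => //.
  by have := Z0 (esym v0); apply: filterS => w + _ => ->; rewrite expr0n.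
have s0 : 0 < Num.sqrt v by rewrite sqrtr_gt0.
have msq : measurable_fun [set: measurableTypeR R] (fun x : R => (x ^+ 2)%:E).
  by apply/measurable_EFinP; exact: measurable_funX.
have sq0 (x : R) : (0 <= (x ^+ 2)%:E)%E by rewrite lee_fin sqr_ge0.
(* The normal law lives on the Borel structure generated by half-open intervals,
   so the image measure is taken for that structure. *)
have mZR : measurable_fun [set: S] (Z : S -> measurableTypeR R) := mZ.
pose ZR : {mfun S >-> measurableTypeR R} :=
  HB.pack (Z : S -> measurableTypeR R) (isMeasurableFun.Build _ _ _ _ _ mZR).
have -> : (\int[P]_w (Z w ^+ 2)%:E = \int[pushforward P ZR]_x (x ^+ 2)%:E)%E.
  by rewrite ge0_integral_pushforward.
rewrite (eq_measure_integral (normal_prob 0 (Num.sqrt v))) => [|A mA _]; last exact: Zv.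
rewrite ge0_integral_normal_prob//.
apply: (@le_trans _ _ (\int[mu]_x ((8 * v)%:E * (normal_pdf 0 (2 * Num.sqrt v) x)%:E)))%E.
  have mpdf s : measurable_fun [set: measurableTypeR R] (fun x => (normal_pdf 0 s x)%:E).
    by apply/measurable_EFinP; exact: measurable_normal_pdf.
  apply: ge0_le_integral => //.
  - by move=> x _; rewrite mule_ge0// lee_fin normal_pdf_ge0.
  - exact: emeasurable_funM.
  - by apply: measurable_funeM.
  - move=> x _; rewrite -!EFinM lee_fin.
    by have := normal_pdf_second_moment x s0; rewrite sqr_sqrtr// ltW.
rewrite ge0_integralZl//; first by rewrite integral_normal_pdf mule1.
- by apply/measurable_EFinP; exact: measurable_normal_pdf.
- by move=> x _; rewrite lee_fin normal_pdf_ge0.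
- by rewrite lee_fin mulr_ge0// ltW.
Qed.

End gaussian_second_moment.
(** * Wiener integrals *)

Section wiener_integral.
Context {R : realType} {d : measure_display} {S : measurableType d}.
Variable P : probability S R.
Context {Y : hilbertType R}.
Variables (T : R) (W : R -> Y -> {RV P >-> R}).
Hypothesis Wiener : cylindrical_wiener T W.

Lemma step_fun_inner n (s : nat -> R) (y : nat -> Y) z r :
  inner (step_fun n s y r) z = \sum_(k < n) \1_(`]s k, s k.+1]) r * inner (y k) z.
Proof. by rewrite /step_fun inner_suml; apply: eq_bigr => k _; rewrite innerZl. Qed.

(** At most one of the intervals ]s_k, s_(k+1)] contains r. *)
Lemma step_fun_norm_sq n (s : nat -> R) (y : nat -> Y) r : nondecreasing_seq s ->
  `|step_fun n s y r| ^+ 2 = \sum_(k < n) \1_(`]s k, s k.+1]) r * `|y k| ^+ 2.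
Proof.
move=> smono; rewrite -inner_norm step_fun_inner; apply: eq_bigr => k _.
rewrite [X in X * _]indicE [X in _ = X * _]indicE mem_setE in_itv/=.
case: (ltP (s k) r) => [skr|]; last by rewrite !mul0r.
case: (leP r (s k.+1)) => [rsk|]; last by rewrite !mul0r.
rewrite innerC step_fun_inner (bigD1 k)//= big1 ?addr0.
  by rewrite inner_norm indicE mem_setE in_itv/= skr rsk !mul1r.
move=> l lk; rewrite indicE mem_setE in_itv/=.
have [kl|kl] := ltnP k l.
  have -> : (s l < r) = false by rewrite ltNge (le_trans rsk)//; exact: smono.
  by rewrite mul0r.
have {}kl : (l < k)%N by rewrite ltn_neqAle kl andbT; exact: lk.
have -> : (r <= s l.+1) = false by rewrite leNgt (le_lt_trans _ skr)//; exact: smono.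
by rewrite andbF mul0r.
Qed.

(** Increments of a process with covariance min (s, t) over disjoint intervals are
    uncorrelated. *)
Lemma increment_covariance (s : nat -> R) k l : nondecreasing_seq s ->
  Num.min (s k.+1) (s l.+1) - Num.min (s k.+1) (s l)
  - (Num.min (s k) (s l.+1) - Num.min (s k) (s l)) =
  if k == l then s k.+1 - s k else 0.
Proof.
move=> smono.
wlog kl : k l / (k <= l)%N.
  move=> h; have [kl|/ltnW lk] := leqP k l; first exact: h.
  rewrite eq_sym; case: eqVneq (h _ _ lk) => [-> //|lk' <-].
  rewrite !(minC (s k.+1)) !(minC (s k)); ring.
have [->|klne] := eqVneq k l.
  rewrite !minxx (min_r (smono _ _ (leqnSn l))) (min_l (smono _ _ (leqnSn l))); ring.
have lt : (k < l)%N by rewrite ltn_neqAle klne.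
rewrite !(min_l (smono _ _ _)) ?subrr//.
exact: leq_trans (leqnSn _).
Qed.

(** The sum of n increments is a combination of 2n values of the process, with
    coefficients 1 and -1, to which joint Gaussianity applies. *)
Lemma step_int_second_moment n (s : nat -> R) (y : nat -> Y) (t : R) :
  t <= T -> s 0%N = 0 -> s n = t -> nondecreasing_seq s ->
  (\int[P]_w (step_int W n s y w ^+ 2)%:E <=
   (8 * \sum_(k < n) (s k.+1 - s k) * `|y k| ^+ 2)%:E)%E.
Proof.
move=> tT s0 sn smono.
have sT k : (k <= n)%N -> 0 <= s k <= T.
  move=> kn; apply/andP; split; first by rewrite -s0; exact: smono.
  by apply: le_trans tT; rewrite -sn; exact: smono.
pose c (i : 'I_(n + n)) : R := if fintype.split i is inl _ then 1 else -1.
pose tt (i : 'I_(n + n)) : R := match fintype.split i with inl k => s k.+1 | inr k => s k end.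
pose yy (i : 'I_(n + n)) : Y := match fintype.split i with inl k => y k | inr k => y k end.
have splitl (k : 'I_n) : fintype.split (lshift n k) = inl k by exact: (unsplitK (inl k)).
have splitr (k : 'I_n) : fintype.split (rshift n k) = inr k by exact: (unsplitK (inr k)).
have ttT i : 0 <= tt i <= T.
  rewrite /tt; case: (fintype.split i) => k; first by apply: sT; exact: ltn_ord.
  by apply: sT; exact: ltnW.
have := Wiener.1 _ c tt yy ttT.
have -> : (fun w => \sum_i c i * W (tt i) (yy i) w) = step_int W n s y.
  apply/funext => w; rewrite big_split_ord/= /step_int sumrB -sumrN; congr (_ + _);
    apply: eq_bigr => k _; rewrite /c /tt /yy ?splitl ?splitr ?mul1r ?mulN1r//.
set v := \sum_i _.
have -> : v = \sum_(k < n) (s k.+1 - s k) * `|y k| ^+ 2.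
  rewrite /v big_split_ord/= -big_split/=; apply: eq_bigr => k _.
  rewrite !big_split_ord/= /c /tt /yy.
  under eq_bigr do rewrite !splitl !mul1r.
  under [X in _ + X + _]eq_bigr do rewrite !splitl !splitr mul1r mulN1r.
  under [X in _ + (X + _)]eq_bigr do rewrite !splitl !splitr mulr1 mulN1r.
  under [X in _ + (_ + X)]eq_bigr do rewrite !splitr mulrNN mulr1 mul1r.
  rewrite -!big_split/= (bigD1 k)//= big1 ?addr0.
    have := increment_covariance k k smono; rewrite eqxx inner_norm => <-; ring.
  move=> l lk; have := increment_covariance k l smono.
  have -> : (k == l :> nat) = false by rewrite eq_sym; exact: negbTE lk.
  move=> h.
  transitivity ((Num.min (s k.+1) (s l.+1) - Num.min (s k.+1) (s l)
  - (Num.min (s k) (s l.+1) - Num.min (s k) (s l))) * inner (y k) (y l)); first ring.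
  by rewrite h mul0r.
move=> /centered_gaussian_second_moment; apply.
  rewrite /step_int; apply: measurable_sum => k.
  exact: measurable_funB.
by apply: sumr_ge0 => k _; rewrite mulr_ge0 ?sqr_ge0// subr_ge0; exact: smono.
Qed.

Local Notation leb := (@lebesgue_measure R).

Lemma measurable_step_fun_inner n (s : nat -> R) (y : nat -> Y) z :
  measurable_fun [set: measurableTypeR R] (fun r => inner (step_fun n s y r) z).
Proof.
under eq_fun do rewrite step_fun_inner.
by apply: measurable_sum => k; apply: measurable_funM.
Qed.

Lemma measurable_step_fun_norm_sq n (s : nat -> R) (y : nat -> Y) :
  nondecreasing_seq s ->
  measurable_fun [set: measurableTypeR R] (fun r => `|step_fun n s y r| ^+ 2).
Proof.
move=> smono; under eq_fun do rewrite step_fun_norm_sq//.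
by apply: measurable_sum => k; apply: measurable_funM.
Qed.

Lemma step_fun_L2 n (s : nat -> R) (y : nat -> Y) (t : R) :
  s 0%N = 0 -> s n = t -> nondecreasing_seq s ->
  (\int[leb]_(r in `[0%R, t]) (`|step_fun n s y r| ^+ 2)%:E)%E =
  (\sum_(k < n) (s k.+1 - s k) * `|y k| ^+ 2)%:E.
Proof.
move=> s0 sn smono.
under eq_integral do rewrite step_fun_norm_sq// -sumEFin.
rewrite ge0_integral_sum//; last first.
  by move=> k; apply/measurable_EFinP/measurable_funM.
rewrite -sumEFin; apply: eq_bigr => k _.
under eq_integral do rewrite EFinM muleC.
rewrite ge0_integralZl//; last first.
  by apply/measurable_EFinP.
rewrite integral_indic//.
have -> : `]s k, s k.+1]%classic `&` `[0, t]%classic = `]s k, s k.+1]%classic.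
  apply: setIidl => r /=; rewrite !in_itv/= => /andP[sr rs].
  apply/andP; split; first by apply: le_trans (ltW sr); rewrite -s0; exact: smono.
  by apply: le_trans rs _; rewrite -sn; apply: smono; exact: ltn_ord.
transitivity ((`|y k| ^+ 2)%:E * @lebesgue_measure R `]s k, s k.+1])%E => //.
suff -> : leb `]s k, s k.+1] = (s k.+1 - s k)%:E by rewrite EFinM muleC.
rewrite lebesgue_measure_itv/= lte_fin; case: ltP => // h.
have -> : s k.+1 = s k; last by rewrite subrr.
by apply: le_anti; rewrite h smono.
Qed.

(** The isometry bound for step functions passes to the limit; each of the two
    approximations costs a factor 2, and 32 = 2 * 8 * 2. *)
Lemma wiener_int_second_moment (t : R) (g : R -> Y) (y0 : Y) (I : S -> R) :
  0 <= t <= T -> measurable_fun [set: S] I ->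
  (forall r, r \in `[0, t] -> g r = y0) -> is_wiener_int W t g I ->
  (\int[P]_w (I w ^+ 2)%:E <= (32 * (t * `|y0| ^+ 2))%:E)%E.
Proof.
move=> /andP[t0 tT] mI gE [n [s [y [sP gcvg Icvg]]]].
set D := (fun j => \int[leb]_(r in `[0%R, t]) _)%E in gcvg.
set E := (fun j => 'E_P[_])%E in Icvg.
have key j : (\int[P]_w (I w ^+ 2)%:E <=
    2%:E * E j + 32%:E * D j + (32 * (t * `|y0| ^+ 2))%:E)%E.
  have [s0 sn smono] := sP j.
  pose A := \sum_(k < n j) (s j k.+1 - s j k) * `|y j k| ^+ 2.
  have mstep : measurable_fun [set: S] (step_int W (n j) (s j) (y j)).
    by apply: measurable_sum => k; exact: measurable_funB.
  have AD : (A%:E <= 2%:E * D j + (2 * (t * `|y0| ^+ 2))%:E)%E.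
    rewrite /A -(step_fun_L2 _ s0 sn smono).
    have mitv : measurable (`[0, t]%classic : set (measurableTypeR R)) by [].
    have mdist : measurable_fun (`[0, t]%classic : set (measurableTypeR R))
        (fun r => (`|g r - step_fun (n j) (s j) (y j) r| ^+ 2)%:E).
      apply/measurable_EFinP.
      apply: (eq_measurable_fun (fun r => `|y0| ^+ 2
        - 2 * inner (step_fun (n j) (s j) (y j) r) y0
        + `|step_fun (n j) (s j) (y j) r| ^+ 2)).
        move=> r; rewrite inE/= => rt; rewrite gE// -!inner_norm.
        by rewrite !(innerBl, innerBr) (innerC y0 (step_fun _ _ _ _)); ring.
      apply: measurable_funTS; apply: measurable_funD.
        apply: measurable_funB => //; apply: measurable_funM => //.
        exact: measurable_step_fun_inner.
      exact: measurable_step_fun_norm_sq.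
    apply: (@le_trans _ _ (\int[leb]_(r in `[0%R, t])
      (2%:E * (`|g r - step_fun (n j) (s j) (y j) r| ^+ 2)%:E
        + (2 * `|y0| ^+ 2)%:E)))%E.
      apply: ge0_le_integral => //.
      - by apply/measurable_EFinP/measurable_funTS; exact: measurable_step_fun_norm_sq.
      - by apply: emeasurable_funD => //; exact: measurable_funeM.
      - move=> r rt; rewrite -EFinM -EFinD lee_fin gE//.
        have := normD_sq (step_fun (n j) (s j) (y j) r - y0) y0.
        by rewrite subrK (distrC _ y0).
    rewrite ge0_integralD//; last exact: measurable_funeM.
    rewrite ge0_integralZl// integral_cst//.
    have lebt : leb `[0, t] = t%:E.
      rewrite lebesgue_measure_itv/= lte_fin oppr0 adde0.
      by case: ltP => // h; have -> : t = 0 by apply: le_anti; rewrite t0 h.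
    apply: (@le_trans _ _ (2%:E * D j + (2 * `|y0| ^+ 2)%:E * leb `[0%R, t])%E) => //.
    by rewrite lebt -EFinM -mulrA (mulrC (_ ^+ 2)).
  have stepA := step_int_second_moment (y j) tT s0 sn smono.
  rewrite -/A in stepA.
  have D0 : (0 <= D j)%E by apply: integral_ge0 => r _; rewrite lee_fin sqr_ge0.
  have E0 : E j = (\int[P]_w ((I w - step_int W (n j) (s j) (y j) w) ^+ 2)%:E)%E.
    by rewrite /E unlock.
  apply: (@le_trans _ _ (\int[P]_w (2%:E * ((I w - step_int W (n j) (s j) (y j) w) ^+ 2)%:E
      + 2%:E * (step_int W (n j) (s j) (y j) w ^+ 2)%:E)))%E.
    apply: ge0_le_integral => //.
    - by move=> w _; rewrite lee_fin sqr_ge0.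
    - by apply/measurable_EFinP; exact: measurable_funX.
    - apply: emeasurable_funD; apply: measurable_funeM; apply/measurable_EFinP;
        apply: measurable_funX => //; exact: measurable_funB.
    - move=> w _; rewrite -!EFinM -EFinD lee_fin.
      set a := I w; set b := step_int _ _ _ _ _.
      by have := sqr_ge0 (a - 2 * b); rewrite !expr2; lra.
  rewrite ge0_integralD//; last first.
  - by apply: measurable_funeM; apply/measurable_EFinP; exact: measurable_funX.
  - by move=> w _; rewrite mule_ge0// lee_fin sqr_ge0.
  - by apply: measurable_funeM; apply/measurable_EFinP/measurable_funX; exact: measurable_funB.
  - by move=> w _; rewrite mule_ge0// lee_fin sqr_ge0.
  rewrite !ge0_integralZl//; last first.
  - by move=> w _; rewrite lee_fin sqr_ge0.
  - by apply/measurable_EFinP/measurable_funX; exact: measurable_funB.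
  - by move=> w _; rewrite lee_fin sqr_ge0.
  - by apply/measurable_EFinP; exact: measurable_funX.
  rewrite -E0 -addeA leeD2l//.
  apply: (@le_trans _ _ (2%:E * (8 * A)%:E)%E); first exact: lee_wpmul2l.
  apply: (@le_trans _ _ (16%:E * A%:E)%E).
    by rewrite -!EFinM lee_fin; lra.
  apply: (@le_trans _ _ (16%:E * (2%:E * D j + (2 * (t * `|y0| ^+ 2))%:E))%E).
    exact: lee_wpmul2l.
  rewrite ge0_muleDr ?mule_ge0 ?lee_fin ?mulr_ge0 ?sqr_ge0//.
  apply: leeD; last by rewrite -EFinM lee_fin; lra.
  rewrite muleA -EFinM (_ : 16 * 2 = 32 :> R)//; ring.
have cv : (2%:E * E j + 32%:E * D j + (32 * (t * `|y0| ^+ 2))%:E)%E @[j --> \oo]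
    --> (2%:E * 0 + 32%:E * 0 + (32 * (t * `|y0| ^+ 2))%:E)%E.
  apply: cvgeD; [by []| |exact: cvg_cst].
  by apply: cvgeD; [rewrite !mule0|exact: cvgeZl|exact: cvgeZl].
rewrite !mule0 !add0e in cv.
rewrite -(cvg_lim _ cv)//; apply: lime_ge; first by apply/cvg_ex; eexists; exact: cv.
exact: nearW.
Qed.

End wiener_integral.
(** * Scalar estimates and the balancing function *)

Section spectral_filters.
Context {R : realType}.

Lemma powR_succ (p x : R) : 0 < x -> x `^ (p + 1) = x * x `^ p.
Proof.
move=> x0; rewrite powRD; first by rewrite powRr1 ?(ltW x0)// mulrC.
by apply/implyP => _; rewrite gt_eqF.
Qed.

(** Equivalently l^p / (eps^(p+1) + l^(p+1)) <= 1 / eps; the larger of l and eps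
    decides which term on the right is used. *)
Lemma powR_filter_le (p eps l : R) : 0 < p -> 0 < eps -> 0 < l ->
  eps * l `^ p <= eps `^ (p + 1) + l `^ (p + 1).
Proof.
move=> p0 e0 l0; rewrite !powR_succ//; have [le|el] := leP l eps.
  rewrite ler_wpDr ?mulr_ge0 ?powR_ge0 ?(ltW l0)//.
  by rewrite ler_wpM2l ?(ltW e0)// ge0_ler_powR ?nnegrE ?(ltW p0) ?(ltW l0) ?(ltW e0).
rewrite ler_wpDl ?mulr_ge0 ?powR_ge0 ?(ltW e0)//.
by rewrite ler_wpM2r ?powR_ge0// ltW.
Qed.

Lemma index_filter_le (p : R) (phi : R -> R) (eps l : R) :
  index_function phi ->
  (forall x y : R, 0 < x -> x <= y ->
    phi y / y `^ (p + 1) <= phi x / x `^ (p + 1)) ->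
  0 < eps -> 0 < l ->
  eps `^ (p + 1) / (eps `^ (p + 1) + l `^ (p + 1)) * phi l <= phi eps.
Proof.
move=> [_ phi_gt0 phi_mono _ _] phi_decr e0 l0.
have E0 : 0 < eps `^ (p + 1) by rewrite powR_gt0.
have L0 : 0 < l `^ (p + 1) by rewrite powR_gt0.
have D0 : 0 < eps `^ (p + 1) + l `^ (p + 1) by rewrite addr_gt0.
rewrite mulrAC ler_pdivrMr//.
have pe := phi_gt0 _ e0; have [le|el] := leP l eps.
  rewrite mulrC; apply: (@le_trans _ _ (phi eps * eps `^ (p + 1))).
    by rewrite ler_wpM2r ?(ltW E0)// phi_mono.
  by rewrite ler_wpM2l ?(ltW pe)// lerDl ltW.
have := phi_decr _ _ e0 (ltW el).
rewrite ler_pdivrMr// mulrAC ler_pdivlMr// => h.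
rewrite mulrC (le_trans h)// ler_wpM2l ?(ltW pe)//.
by rewrite lerDr ltW.
Qed.

(** The square of Theta is x phi(x)^2 / N(x^(p+1)), which increases strictly.
    The hypotheses allow N x = 0 because a trace that is infinite is given the
    value 0; Theta vanishes at such points. *)
Lemma Theta_injective (p : R) (phi N : R -> R) :
  index_function phi -> 0 < p -> (forall x, 0 < x -> 0 <= N x) ->
  (forall x y, 0 < x -> x <= y -> N x != 0 -> N y != 0 -> N y <= N x) ->
  forall x y : R, 0 < x -> 0 < y -> 0 < Theta p phi N x ->
    Theta p phi N x = Theta p phi N y -> x = y.
Proof.
move=> [_ phi_gt0 phi_mono _ _] p0 N0 Nmono.
have NP z : 0 < z -> 0 < Theta p phi N z -> 0 < N (z `^ (p + 1)).
  move=> z0 T0; rewrite lt_neqAle N0 ?powR_gt0// andbT; apply/eqP => Nz.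
  by move: T0; rewrite /Theta -Nz mulr0 sqrtr0 invr0 mulr0 ltxx.
have lt x y : 0 < x -> x < y -> 0 < Theta p phi N x -> 0 < Theta p phi N y ->
    Theta p phi N x < Theta p phi N y.
  move=> x0 xy Tx Ty; have y0 := lt_trans x0 xy.
  have Nx := NP _ x0 Tx; have Ny := NP _ y0 Ty.
  have Nxy : N (y `^ (p + 1)) <= N (x `^ (p + 1)).
    apply: Nmono; rewrite ?powR_gt0 ?gt_eqF//.
    by rewrite ge0_ler_powR ?nnegrE ?(ltW x0) ?(ltW y0) ?(ltW xy)// addr_ge0// ltW.
  have sqE z : 0 < z -> 0 < N (z `^ (p + 1)) ->
      Theta p phi N z ^+ 2 = z * phi z ^+ 2 / N (z `^ (p + 1)).
    move=> z0 Nz; rewrite /Theta exprMn exprVn sqr_sqrtr ?mulr_ge0 ?ltW//.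
    by field; rewrite !gt_eqF.
  rewrite -ltr_sqr ?nnegrE ?(ltW Tx) ?(ltW Ty)// !sqE//.
  have px := phi_gt0 _ x0; have py := phi_gt0 _ y0.
  rewrite ltr_pdivrMr// mulrAC ltr_pdivlMr//.
  apply: (@lt_le_trans _ _ (y * phi x ^+ 2 * N (y `^ (p + 1)))).
    by rewrite ltr_pM2r// ltr_pM2r// exprn_gt0.
  rewrite ler_pM ?mulr_ge0 ?(ltW y0) ?(ltW px) ?(ltW Ny)//.
  rewrite ler_wpM2l ?(ltW y0)// ler_sqr ?nnegrE ?(ltW px) ?(ltW py)//.
  by rewrite phi_mono// ltW.
move=> x y x0 y0 Tx Txy; have Ty : 0 < Theta p phi N y by rewrite -Txy.
case: (ltgtP x y) => // xy.
  by have := lt _ _ x0 xy Tx Ty; rewrite Txy ltxx.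
by have := lt _ _ y0 xy Ty Tx; rewrite Txy ltxx.
Qed.

Lemma inv_on_eq (D : set R) (f : R -> R) (x v : R) : D x -> f x = v ->
  (forall y, D y -> f y = v -> y = x) -> inv_on 0 D f v = x.
Proof.
move=> Dx fx uniq.
have sD : set_surj D (f @` D) f by [].
have vD : (f @` D) v by exists x.
apply: uniq; last by apply: (surjpK _ sD); exact: mem_set.
by apply: (surjpinv_image_sub sD); exists v.
Qed.

End spectral_filters.

Section hilbert_random_variables.
Context {R : realType} {d : measure_display} {S : measurableType d}.
Context {X : hilbertType R}.

Lemma hilbert_rv_comp (Z : S -> X) (h : X -> R) : hilbert_rv Z -> continuous h ->
  measurable_fun [set: S] (h \o Z).
Proof.
move=> hZ ch; apply: (measurability _ (RGenOInfty.measurableE R)).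
move=> _ [_ [x ->] <-]; rewrite setTI.
apply: (hZ (h @^-1` `]x, +oo[%classic)); apply: open_comp; last exact: interval_open.
by move=> y _; exact: ch.
Qed.

End hilbert_random_variables.

Section positive_square_root.
Context {R : realType} {X : hilbertType R}.

(** The vector z = S x - sqrt w x satisfies S z = - sqrt w z, which for a
    nonnegative S and w > 0 forces z = 0. *)
Lemma sqrt_op_eigen (T S : X -> X) (w : R) (x : X) :
  (forall a x y, S (a *: x + y) = a *: S x + S y) ->
  (forall x, 0 <= inner x (S x)) -> (forall x, S (S x) = T x) ->
  0 < w -> T x = w *: x -> S x = Num.sqrt w *: x.
Proof.
move=> Slin S0 SS w0 Tx; have sw0 : 0 < Num.sqrt w by rewrite sqrtr_gt0.
pose z := S x - Num.sqrt w *: x.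
have Sz : S z = - (Num.sqrt w *: z).
  rewrite /z (linB Slin) SS Tx (linZ Slin) scalerBr scalerA -expr2.
  by rewrite sqr_sqrtr ?ltW// opprB.
apply/eqP; rewrite -subr_eq0 -/z -inner_eq0.
have := S0 z; rewrite Sz innerNr innerZr oppr_ge0 pmulr_rle0// => h.
by rewrite eq_le h inner_ge0.
Qed.

End positive_square_root.
(** * Effective dimension and error decomposition *)

Section effective_dimension.
Context {R : realType} {X Y : hilbertType R}.
Variables (E : set X) (B : X -> Y) (f : nat -> X) (mu : nat -> R).
Hypothesis sepX : separable X.
Hypothesis E_basis : orthonormal_basis E.
Hypothesis fP : basis_seq f.
Hypothesis mu_ge0 : forall i, 0 <= mu i.
Hypothesis Bmu : forall x i, inner (normal_op B x) (f i) = mu i * inner x (f i).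

(** The effective dimension as an extended real, before its conversion to a real
    number. *)
Definition eigen_dim (eps : R) : \bar R :=
  (\sum_(0 <= i <oo) (mu i / (eps + mu i) * inner (f i) (f i))%:E)%E.

Let ratio01 (eps : R) i : 0 < eps -> 0 <= mu i / (eps + mu i) <= 1.
Proof.
move=> e0; have m0 := mu_ge0 i; have d0 : 0 < eps + mu i by rewrite ltr_pwDl.
by rewrite divr_ge0 ?(ltW d0)//= ler_pdivrMr// mul1r lerDr ltW.
Qed.

Lemma eigen_dim_ge0 eps : 0 < eps -> (0 <= eigen_dim eps)%E.
Proof.
move=> e0; apply: nneseries_ge0 => i _ _.
by rewrite lee_fin mulr_ge0 ?inner_ge0//; case/andP: (ratio01 i e0).
Qed.

Lemma eigen_dim_antitone eps eps' : 0 < eps -> eps <= eps' ->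
  (eigen_dim eps' <= eigen_dim eps)%E.
Proof.
move=> e0 ee; have e0' := lt_le_trans e0 ee.
apply: lee_nneseries => i _.
  by rewrite lee_fin mulr_ge0 ?inner_ge0//; case/andP: (ratio01 i e0').
rewrite lee_fin ler_wpM2r ?inner_ge0// ler_wpM2l//.
by rewrite lef_pV2 ?posrE ?ltr_pwDl// lerD2r.
Qed.

Lemma effective_dimE eps : 0 < eps -> effective_dim E B eps = fine (eigen_dim eps).
Proof.
move=> e0; congr fine; rewrite /op_trace.
have rb i : `|mu i / (eps + mu i)| <= 1.
  by have /andP[r0 r1] := ratio01 i e0; rewrite ger0_norm.
have invE x : op_inv setT (fun z => eps *: z + normal_op B z) (normal_op B x) =
    diag f (fun i => mu i / (eps + mu i)) x.
  have TE z i : inner (eps *: z + normal_op B z) (f i) = (eps + mu i) * inner z (f i).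
    by rewrite innerDl innerZl Bmu mulrDl.
  have d0 i : eps + mu i != 0 by rewrite gt_eqF// ltr_pwDl.
  apply: op_inv_eq => // [z z' _ _ zz'|].
    by apply: (basis_ext fP) => i; apply: (mulfI (d0 i)); rewrite -!TE zz'.
  by apply: (basis_ext fP) => i; rewrite TE (diagE fP rb) Bmu; field.
have [e [eP _ esumE]] := orthonormal_basis_seq sepX E_basis.
have qE x : (inner (diag f (fun i => mu i / (eps + mu i)) x) x)%:E =
    (\sum_(0 <= i <oo) (mu i / (eps + mu i) * inner x (f i) ^+ 2)%:E)%E.
  by rewrite -(diag_quadratic fP (C := 1))// => i; exact: ratio01.
transitivity (\esum_(x in E) (inner (diag f (fun i => mu i / (eps + mu i)) x) x)%:E)%E.
  by apply: eq_esum => x _; rewrite invE.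
rewrite esumE => [|x|]; last by rewrite inner0r.
  by rewrite (trace_diag eP fP (C := 1))// => i; exact: ratio01.
rewrite qE; apply: nneseries_ge0 => i _ _.
by rewrite lee_fin mulr_ge0 ?sqr_ge0//; case/andP: (ratio01 i e0).
Qed.

End effective_dimension.

Section arm_error.
Context {R : realType} {X Y : hilbertType R}.
Variables (K : X -> Y) (Om : X -> X) (f : nat -> X) (lam om : nat -> R) (alpha T : R).
Hypothesis Kadj : forall x y, inner (K x) y = inner x (adj K y).
Hypothesis fP : basis_seq f.
Hypothesis lam01 : forall i, 0 < lam i <= 1.
Hypothesis om01 : forall i, 0 < om i <= 1.
Hypothesis Klam : forall x i, inner (normal_op K x) (f i) = lam i * inner x (f i).
Hypothesis Omom : forall x i, inner (Om x) (f i) = om i * inner x (f i).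
Hypothesis alpha_gt0 : 0 < alpha.
Hypothesis T_gt0 : 0 < T.

Local Notation C0 := (fun x => alpha^-1 *: Om x).
Local Notation mu i := (lam i * om i).

Let den_gt0 i : 0 < alpha + T * mu i.
Proof.
have /andP[l0 _] := lam01 i; have /andP[p0 _] := om01 i.
by rewrite addr_gt0// !mulr_gt0.
Qed.

Lemma arm_bias_le (C : R) (w v : X) (psi : nat -> R) : 0 <= C ->
  (forall i, inner w (f i) = psi i * inner v (f i)) ->
  (forall i, alpha / (alpha + T * mu i) * `|psi i| <= C) ->
  `|arm_prop C0 K 0 T w| <= C * `|v|.
Proof.
move=> C0' wE psiC.
rewrite (arm_prop_diag fP lam01 om01 Klam Omom alpha_gt0 w (lexx 0) (ltW T_gt0)).
have rb i : `|(alpha + 0 * mu i) / (alpha + T * mu i)| <= 1.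
  have /andP[l0 _] := lam01 i; have /andP[p0 _] := om01 i.
  rewrite mul0r addr0 ger0_norm; last by rewrite divr_ge0 ?(ltW alpha_gt0) ?(ltW (den_gt0 _)).
  by rewrite ler_pdivrMr// mul1r lerDl !mulr_ge0 ?(ltW T_gt0) ?(ltW l0) ?(ltW p0).
apply: (norm_le_coef fP) => // i; rewrite (diagE fP rb) wE mul0r addr0 mulrA normrM.
rewrite ler_wpM2r// normrM (le_trans _ (psiC i))// ler_wpM2r//.
by rewrite ger0_norm// divr_ge0 ?(ltW alpha_gt0) ?(ltW (den_gt0 _)).
Qed.

(** In the direction f_i the integrand of the noise is constant in time. *)
Lemma arm_kernel_adj r i : r \in `[0, T] ->
  adj (fun y => arm_prop C0 K r T (arm_cov C0 K r (adj K y))) (f i) =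
  (om i / (alpha + T * mu i)) *: K (f i).
Proof.
rewrite in_itv/= => /andP[r0 rT]; apply: adj_eq => y.
rewrite (arm_prop_cov_diag fP lam01 om01 Klam Omom alpha_gt0 _ r0 rT).
have hb j : `|om j / (alpha + T * mu j)| <= alpha^-1.
  have /andP[l0 _] := lam01 j; have /andP[p0 p1] := om01 j.
  rewrite ger0_norm; last by rewrite divr_ge0 ?(ltW p0) ?(ltW (den_gt0 _)).
  apply: (@le_trans _ _ (1 / (alpha + T * mu j))).
    by rewrite ler_wpM2r// invr_ge0 ltW.
  by rewrite div1r lef_pV2 ?posrE// lerDl !mulr_ge0 ?(ltW T_gt0) ?(ltW l0) ?(ltW p0).
by rewrite (diagE fP hb) innerZr [in RHS]innerC Kadj innerC.
Qed.

Context {d : measure_display} {S : measurableType d}.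
Variable P : probability S R.
Variable W : R -> Y -> {RV P >-> R}.
Hypothesis Wiener : cylindrical_wiener T W.

(** Sum the second moments of the coordinates of the noise; the i-th one is the
    Wiener integral of a constant of squared norm (om_i / (alpha + T mu_i))^2 lam_i. *)
Lemma arm_noise_second_moment (Z : S -> X) :
  is_stoch_int W T
    (fun s y => arm_prop C0 K s T (arm_cov C0 K s (adj K y))) Z ->
  (\int[P]_w (`|Z w| ^+ 2)%:E <= \sum_(0 <= i <oo)
     (32 * (T * ((om i / (alpha + T * mu i)) ^+ 2 * (lam i * inner (f i) (f i)))))%:E)%E.
Proof.
move=> [rvZ ZW].
have mZ i : measurable_fun [set: S] (fun w => inner (Z w) (f i)).
  apply: (hilbert_rv_comp (h := inner^~ (f i)) rvZ) => x.
  by apply: (@cvg_innerl R X X (nbhs x) _ id x (f i)); exact: cvg_id.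
have -> : (\int[P]_w (`|Z w| ^+ 2)%:E =
    \int[P]_w (\sum_(0 <= i <oo) (inner (Z w) (f i) ^+ 2)%:E))%E.
  by apply: eq_integral => w _; rewrite (parseval_ereal fP).
rewrite integral_nneseries//; last first.
- by move=> i w _; rewrite lee_fin sqr_ge0.
- by move=> i; apply/measurable_EFinP; exact: measurable_funX.
apply: lee_nneseries => i _.
  by move=> _; apply: integral_ge0 => w _; rewrite lee_fin sqr_ge0.
have TT : 0 <= T <= T by rewrite (ltW T_gt0) lexx.
have := wiener_int_second_moment Wiener TT (mZ i) (@arm_kernel_adj ^~ i) (ZW (f i)).
rewrite normrZ exprMn real_normK ?num_real//.
suff -> : `|K (f i)| ^+ 2 = lam i * inner (f i) (f i) by [].
by rewrite -inner_norm Kadj innerC -Klam.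
Qed.

End arm_error.
Section mean_square_error.
Context {R : realType} {X : hilbertType R}.

(** One of the two factors lam_i^p / (eps^(p+1) + mu_i) is bounded by 1 / eps; the
    other one, times lam_i, is the summand of the effective dimension. *)
Lemma noise_eigen_dim_le (f : nat -> X) (lam : nat -> R) (p eps T : R) :
  0 < p -> 0 < eps -> 0 < T -> (forall i, 0 < lam i) ->
  (\sum_(0 <= i <oo) (32 * (T * ((lam i `^ p /
       (T * eps `^ (p + 1) + T * (lam i * lam i `^ p))) ^+ 2 *
       (lam i * inner (f i) (f i)))))%:E <=
   (32 / (T * eps))%:E *
     eigen_dim f (fun i => lam i * lam i `^ p)%R (eps `^ (p + 1))%R)%E.
Proof.
move=> p0 e0 T0 lam0.
have delta0 : 0 < eps `^ (p + 1) by rewrite powR_gt0.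
have om0 i : 0 < lam i `^ p by rewrite powR_gt0.
have mu0 i : 0 < lam i * lam i `^ p by rewrite mulr_gt0.
have D0 i : 0 < eps `^ (p + 1) + lam i * lam i `^ p by rewrite addr_gt0.
rewrite /eigen_dim -nneseriesZl; last first.
  by move=> i _; rewrite lee_fin mulr_ge0 ?inner_ge0// divr_ge0// ltW.
apply: lee_nneseries => i _.
  move=> _; rewrite lee_fin mulr_ge0// mulr_ge0 ?(ltW T0)//.
  by rewrite mulr_ge0 ?sqr_ge0// mulr_ge0 ?inner_ge0// ltW.
rewrite -EFinM lee_fin -mulrDr.
set D := eps `^ (p + 1) + _; set n := inner _ _.
have key : lam i `^ p / D <= eps^-1.
  rewrite ler_pdivrMr ?D0// mulrC ler_pdivlMr// mulrC /D -powR_succ//.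
  exact: powR_filter_le.
have -> : 32 * (T * ((lam i `^ p / (T * D)) ^+ 2 * (lam i * n))) =
    32 / T * (lam i * lam i `^ p / D * n) * (lam i `^ p / D).
  by field; rewrite !gt_eqF ?D0.
have -> : 32 / (T * eps) * (lam i * lam i `^ p / D * n) =
    32 / T * (lam i * lam i `^ p / D * n) * eps^-1.
  by field; rewrite !gt_eqF ?D0.
rewrite ler_wpM2l// mulr_ge0 ?divr_ge0 ?(ltW T0)//.
by rewrite mulr_ge0 ?divr_ge0 ?inner_ge0 ?(ltW (mu0 i)) ?(ltW (D0 i)).
Qed.

Context {d : measure_display} {S : measurableType d}.
Variable P : probability S R.

Lemma mean_square_split (V Z : S -> X) (a b : X) (beta zeta : R) :
  hilbert_rv V -> hilbert_rv Z -> {ae P, forall w, a - V w = b - Z w} ->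
  `|b| <= beta -> (\int[P]_w (`|Z w| ^+ 2)%:E <= zeta%:E)%E ->
  ('E_P[(fun w => `|V w - a| ^+ 2)%R] <= (2 * beta ^+ 2 + 2 * zeta)%:E)%E.
Proof.
move=> rvV rvZ VZ bb Zz; have beta0 : 0 <= beta := le_trans (normr_ge0 _) bb.
have cnorm (x0 : X) : continuous (fun x : X => `|x - x0| ^+ 2 : R).
  move=> x; apply: (continuous_comp (f := fun x : X => `|x - x0|) (g := fun r : R => r ^+ 2)).
    by apply: cvg_norm; apply: cvgB; [exact: cvg_id|exact: cvg_cst].
  exact: exprn_continuous.
have mnorm (U : S -> X) x0 : hilbert_rv U ->
    measurable_fun setT (fun w => (`|U w - x0| ^+ 2)%:E).
  by move=> hU; apply/measurable_EFinP; exact: (hilbert_rv_comp hU (@cnorm x0)).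
have mZ2 : measurable_fun setT (fun w => (`|Z w| ^+ 2)%:E).
  by have := mnorm Z 0 rvZ; under eq_fun do rewrite subr0.
rewrite unlock.
apply: (@le_trans _ _ (\int[P]_w ((2 * beta ^+ 2)%:E + 2%:E * (`|Z w| ^+ 2)%:E))%E).
  apply: ae_ge0_le_integral => //.
  - exact: mnorm.
  - by move=> w _; rewrite adde_ge0 ?mule_ge0 ?lee_fin// mulr_ge0 ?sqr_ge0.
  - by apply: emeasurable_funD => //; exact: measurable_funeM.
  - apply: filterS VZ => w Vw _; rewrite -EFinM -EFinD lee_fin distrC Vw.
    apply: le_trans (normD_sq _ _) _; rewrite normrN lerD2r ler_wpM2l//.
    by rewrite ler_sqr ?nnegrE.
rewrite ge0_integralD//; last first.
- exact: measurable_funeM.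
- by move=> w _; rewrite lee_fin mulr_ge0 ?sqr_ge0.
rewrite integral_cst//= probability_setT mule1 ge0_integralZl//.
apply: (@le_trans _ _ ((2 * beta ^+ 2)%:E + 2%:E * zeta%:E)%E).
  by rewrite leeD2l// lee_wpmul2l.
by rewrite -EFinM -EFinD.
Qed.

End mean_square_error.

(** * The rate of convergence *)

Section preparation.
Context {R : realType} {X Y : hilbertType R}.

Lemma op_inv_comp_linear (A : X -> Y) (Q : Y -> Y) :
  (forall a x y, A (a *: x + y) = a *: A x + A y) ->
  (forall a x y, Q (a *: x + y) = a *: Q x + Q y) ->
  (forall y, Q y = 0 -> y = 0) -> range A `<=` range Q ->
  forall a x y, (op_inv setT Q \o A) (a *: x + y) =
    a *: (op_inv setT Q \o A) x + (op_inv setT Q \o A) y.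
Proof.
move=> Alin Qlin Qinj AQ a x y /=.
have QK z : Q (op_inv setT Q (A z)) = A z.
  by apply: pinvK; apply/mem_set/AQ; exists z.
have Qinj2 y1 y2 : Q y1 = Q y2 -> y1 = y2.
  by move=> h; apply/eqP; rewrite -subr_eq0; apply/eqP/Qinj; rewrite (linB Qlin) h subrr.
by apply: Qinj2; rewrite Qlin !QK Alin.
Qed.

Lemma adjP (e : nat -> X) (K : X -> Y) : basis_seq e ->
  (forall a x y, K (a *: x + y) = a *: K x + K y) ->
  (forall x, `|K x| <= `|x|) -> forall x y, inner (K x) y = inner x (adj K y).
Proof.
move=> eP Klin K_le1 x y.
have [z zP] : exists z, forall x, inner (K x) y = inner x z.
  apply: (riesz_representation eP (C := `|y|)) => [a u v|u].
    by rewrite Klin innerDl innerZl.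
  by apply: le_trans (cauchy_schwarz _ _) _; rewrite mulrC ler_wpM2l.
by rewrite (adj_eq zP).
Qed.

End preparation.

Theorem corollary3p4 (R : realType) (X Y : hilbertType R)
    (sepX : separable X) (sepY : separable Y)
    (A : {linear X -> Y}) (A_compact : compact_operator A)
    (u m0 : X)
    (Sigma sqrtSigma : {linear Y -> Y}) (Omega sqrtOmega : {linear X -> X})
    (Sigma_sa : selfadjoint Sigma) (Sigma_pd : positive_definite Sigma)
    (sqrtSigmaE : is_sqrt_op Sigma sqrtSigma)
    (Omega_sa : selfadjoint Omega) (Omega_pd : positive_definite Omega)
    (sqrtOmegaE : is_sqrt_op Omega sqrtOmega)
    (E : set X) (E_basis : orthonormal_basis E)
    (Omega_trace : (op_trace E Omega < +oo)%E)
    (A_range : range A `<=` range sqrtSigma)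
    (K : X -> Y) (KE : K = op_inv setT sqrtSigma \o A)
    (K_le1 : forall x, `|K x| <= `|x|)
    (p : R) (p_gt0 : 0 < p)
    (OmegaE : is_op_fun (fun l => l `^ p) (normal_op K) Omega)
    (phi : R -> R) (phi_index : index_function phi)
    (source : source_set phi (normal_op K) (m0 - u))
    (phi_decr : forall x y : R, 0 < x -> x <= y ->
       phi y / y `^ (p + 1) <= phi x / x `^ (p + 1)) :
  let B := K \o sqrtOmega in
  let Th := Theta p phi (effective_dim E B) in
  let Th_inv := inv_on (0 : R) `]0%R, +oo[ Th in
  exists c : R, \forall T \near +oo,
    forall eps alpha : R, 0 < eps -> 0 < alpha ->
      eps = (alpha / T) `^ (p + 1)^-1 ->
      Th eps = Num.sqrt (1 / T) ->
    forall (d : measure_display) (S : measurableType d) (P : probability S R)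
      (W : R -> Y -> {RV P >-> R}) (m : R -> S -> X),
      cylindrical_wiener T W ->
      is_arm (fun x => alpha^-1 *: Omega x) K u m0 T W m ->
      ('E_P[(fun w => `|m T w - u| ^+ 2)%R]
         <= (c * phi (Th_inv (Num.sqrt (1 / T))) ^+ 2)%:E)%E.
Proof.
move=> B Th Th_inv.
have Slin a x y : sqrtOmega (a *: x + y) = a *: sqrtOmega x + sqrtOmega y.
  exact: linearP.
have [[Scont Ssym] Sge0 SS] := sqrtOmegaE.
have Qinj y : sqrtSigma y = 0 -> y = 0.
  move=> Qy; apply/eqP; apply: contraT => /Sigma_pd.
  have [_ _ <-] := sqrtSigmaE.
  by rewrite Qy linear0 inner0r ltxx.
have Klin : forall a x y, K (a *: x + y) = a *: K x + K y.
  rewrite KE; apply: op_inv_comp_linear => //; exact: linearP.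
(* The given basis E provides the coordinates in which the adjoint of K is
   constructed and the trace of Omega is the squared Hilbert-Schmidt norm of
   sqrtOmega. *)
have [e [eP _ esumE]] := orthonormal_basis_seq sepX E_basis.
have Kadj := adjP eP Klin K_le1.
pose H := normal_op K.
have HE x y : inner (H x) y = inner (K x) (K y) by rewrite [RHS]innerC Kadj innerC.
have Hlin := gram_linear Klin HE.
have Hsym := gram_sym HE.
have Hle1 := gram_le1 K_le1 HE.
have Omega0 x : Omega x = 0 -> x = 0.
  move=> Ox; apply/eqP; apply: contraT => /Omega_pd.
  by rewrite Ox inner0r ltxx.
have K_inj x : K x = 0 -> x = 0.
  move=> Kx; apply: Omega0.
  have Hx : H x = 0 *: x.
    by rewrite scale0r; apply: inner_inj => z; rewrite HE Kx !inner0l.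
  rewrite (op_fun_eigen Hlin Hle1 OmegaE (lexx 0) Hx) powR0 ?scale0r//.
  by rewrite gt_eqF.
have traceE : op_trace E Omega = (\sum_(0 <= i <oo) (`|sqrtOmega (e i)| ^+ 2)%:E)%E.
  rewrite /op_trace esumE => [|x|]; last by rewrite inner0r.
    by apply: eq_eseriesr => i _; rewrite -SS Ssym inner_norm.
  by rewrite -SS Ssym inner_norm lee_fin sqr_ge0.
have Scv : cvgn (series (fun i => `|sqrtOmega (e i)| ^+ 2)).
  apply: nondecreasing_is_cvgn.
    by apply/nondecreasing_seqP => n; rewrite !seriesEnat/= big_nat_recr//= lerDl.
  exists (fine (op_trace E Omega)) => _ [n _ <-]; rewrite seriesEnat/= -lee_fin.
  have t0 : (0 <= op_trace E Omega)%E.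
    by rewrite traceE; apply: nneseries_ge0 => i _ _; rewrite lee_fin sqr_ge0.
  rewrite fineK ?ge0_fin_numE// traceE -sumEFin.
  by apply: nneseries_lim_ge => i _ _; rewrite lee_fin sqr_ge0.
have powp_gt0 (l : R) : 0 < l -> 0 < l `^ p by exact: powR_gt0.
have [f [lam [fP lam01 Hlam]]] := gram_eigenbasis Klin K_le1 K_inj HE OmegaE
  powp_gt0 Slin Ssym Scont SS eP Scv sepX.
pose om i := lam i `^ p.
have om01 i : 0 < om i <= 1.
  have /andP[l0 l1] := lam01 i; rewrite powR_gt0//=.
  have := @ge0_ler_powR R p (ltW p_gt0) (lam i) 1.
  by rewrite !nnegrE powR1 => -> //; exact: ltW.
have muE i : lam i * om i = lam i `^ (p + 1).
  by rewrite powR_succ//; case/andP: (lam01 i).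
have Hf i : H (f i) = lam i *: f i.
  by apply: inner_inj => x; rewrite Hsym innerC Hlam innerZl innerC.
have op_funE (h : R -> R) F x i : is_op_fun h H F ->
    inner (F x) (f i) = h (lam i) * inner x (f i).
  move=> hF; have /andP[/ltW l0 _] := lam01 i.
  by rewrite (op_fun_sym Hsym _ _ hF) (op_fun_eigen Hlin Hle1 hF l0 (Hf i)) innerZr.
have Omom x i : inner (Omega x) (f i) = om i * inner x (f i) by exact: (op_funE _ _ _ _ OmegaE).
have Sf i : sqrtOmega (f i) = Num.sqrt (om i) *: f i.
  have /andP[p0 _] := om01 i; have /andP[/ltW l0 _] := lam01 i.
  apply: (sqrt_op_eigen Slin Sge0 SS p0).
  exact: (op_fun_eigen Hlin Hle1 OmegaE l0 (Hf i)).
have Badj y : adj B y = sqrtOmega (adj K y).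
  by apply: adj_eq => x; rewrite /B/= Kadj Ssym.
have Bmu x i : inner (normal_op B x) (f i) = lam i * om i * inner x (f i).
  rewrite /normal_op Badj Ssym Sf innerZr.
  have -> : inner (adj K (B x)) (f i) = inner (H (sqrtOmega x)) (f i) by [].
  rewrite Hlam Ssym Sf innerZr.
  have /andP[/ltW p0 _] := om01 i.
  by rewrite -[X in _ = lam i * X * _](sqr_sqrtr p0); ring.
have mu_ge0 i : 0 <= lam i * om i.
  by have /andP[/ltW ? _] := om01 i; have /andP[/ltW ? _] := lam01 i; rewrite mulr_ge0.
pose N := effective_dim E B.
have NE (x : R) : 0 < x -> N x = fine (eigen_dim f (fun i => lam i * om i) x).
  by move=> x0; apply: effective_dimE.
have N_ge0 (x : R) : 0 < x -> 0 <= N x.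
  by move=> x0; rewrite NE// fine_ge0// eigen_dim_ge0.
(* A nonzero value of N certifies that the trace behind it is finite. *)
have Nfin (x : R) : 0 < x -> N x != 0 ->
    eigen_dim f (fun i => lam i * om i) x = (N x)%:E.
  move=> x0; rewrite NE//; have := eigen_dim_ge0 f mu_ge0 x0.
  by case: (eigen_dim _ _ _) => //=; rewrite eqxx.
have Nmono (x y : R) : 0 < x -> x <= y -> N x != 0 -> N y != 0 -> N y <= N x.
  move=> x0 xy Nx Ny; rewrite -lee_fin -!Nfin ?(lt_le_trans x0 xy)//.
  exact: eigen_dim_antitone.
have Thinj (x y : R) : 0 < x -> 0 < y -> 0 < Th x -> Th x = Th y -> x = y.
  exact: (Theta_injective phi_index p_gt0 N_ge0 Nmono).
have [F [FE [v v1 mF]]] := source.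
have [_ phi_gt0 _ _ _] := phi_index.
(* 66 = 2 + 2 * 32: the bias contributes phi(eps)^2, the noise 32 phi(eps)^2, and
   the square of the sum costs a factor 2. *)
exists 66; near=> T => eps alpha eps0 alpha0 epsE Theps d S P W m Wiener arm.
have T0 : 0 < T by near: T; exact: nbhs_pinfty_gt.
have sqrtT0 : 0 < Num.sqrt (1 / T) by rewrite sqrtr_gt0 divr_gt0.
have p1_gt0 : 0 < p + 1 by rewrite addr_gt0.
have alphaE : alpha = T * eps `^ (p + 1).
  rewrite epsE -powRrM mulVf ?gt_eqF// powRr1 ?divr_ge0 ?ltW//.
  by rewrite mulrC divfK// gt_eqF.
have -> : Th_inv (Num.sqrt (1 / T)) = eps.
  apply: inv_on_eq => //=; first by rewrite in_itv/= eps0.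
  move=> y; rewrite in_itv/= andbT => y0 Thy.
  have Ty : 0 < Th y by rewrite Thy.
  exact: (Thinj _ _ y0 eps0 Ty (etrans Thy (esym Theps))).
have delta0 : 0 < eps `^ (p + 1) by rewrite powR_gt0.
(* Otherwise Theta eps would be a division by zero, hence 0. *)
have N0 : N (eps `^ (p + 1)) != 0.
  apply/eqP => N0; move: sqrtT0; rewrite -Theps /Th /Theta -/N N0.
  by rewrite mulr0 sqrtr0 invr0 mulr0 ltxx.
have Npos : 0 < N (eps `^ (p + 1)) by rewrite lt_neqAle eq_sym N0 N_ge0.
have phiE : N (eps `^ (p + 1)) / (T * eps) = phi eps ^+ 2.
  have := congr1 (fun x => x ^+ 2) Theps.
  rewrite /Th /Theta -/N exprMn exprVn !sqr_sqrtr ?divr_ge0 ?mulr_ge0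
    ?(ltW eps0) ?(ltW Npos) ?(ltW T0)//.
  move=> /(congr1 (fun x => x * N (eps `^ (p + 1)) / eps)).
  have -> : (eps * phi eps) ^+ 2 / (eps * N (eps `^ (p + 1))) *
    N (eps `^ (p + 1)) / eps = phi eps ^+ 2 by field; rewrite !gt_eqF.
  by move=> ->; field; rewrite !gt_eqF.
have TT : 0 <= T <= T by rewrite (ltW T0) lexx.
have [rvm [Z [ZW mZ]]] := arm T TT.
have pe := phi_gt0 _ eps0.
have bias : `|arm_prop (fun x => alpha^-1 *: Omega x) K 0 T (u - m0)| <= phi eps.
  have bw i : inner (u - m0) (f i) = - phi (lam i) * inner v (f i).
    by rewrite -opprB innerNl mF (op_funE _ _ _ _ FE) mulNr.
  apply: le_trans (arm_bias_le fP lam01 om01 Hlam Omom alpha0 T0 (ltW pe) bw _) _.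
    move=> i; have /andP[l0 _] := lam01 i.
    rewrite normrN (ger0_norm (ltW (phi_gt0 _ l0))) muE alphaE -mulrDr.
    rewrite invfM mulrACA mulfV ?gt_eqF// mul1r.
    exact: index_filter_le.
  by rewrite ler_piMr// ltW.
have noise : (\int[P]_w (`|Z w| ^+ 2)%:E <= (32 * phi eps ^+ 2)%:E)%E.
  apply: le_trans (arm_noise_second_moment Kadj fP lam01 om01 Hlam Omom alpha0 T0 Wiener ZW) _.
  rewrite alphaE; apply: le_trans (noise_eigen_dim_le f p_gt0 eps0 T0 _) _.
    by move=> i; case/andP: (lam01 i).
  rewrite Nfin// -EFinM lee_fin -phiE le_eqVlt; apply/orP; left; apply/eqP; ring.
apply: le_trans (mean_square_split rvm ZW.1 mZ bias noise) _.
by rewrite lee_fin le_eqVlt; apply/orP; left; apply/eqP; ring.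
Unshelve. all: by end_near. Qed.
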